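(* If $r$ is a term with $r:A$ for some type $A$, then $r$ is strongly normalising for $\rightsquigarrow$, i.e. there is no infinite sequence $r=r_0\rightsquigarrow r_1\rightsquigarrow r_2\rightsquigarrow\cdots$.
   Context: Types are generated by $A ::= \tau \mid A\Rightarrow A \mid A\wedge A$, where $\tau$ is the only atomic type ($\Rightarrow$ associates to the right). Type equivalence $\equiv$ is the smallest congruence on types such that $A\wedge B\equiv B\wedge A$, $A\wedge(B\wedge C)\equiv(A\wedge B)\wedge C$, $A\Rightarrow(B\wedge C)\equiv(A\Rightarrow B)\wedge(A\Rightarrow C)$ and $(A\wedge B)\Rightarrow C\equiv A\Rightarrow B\Rightarrow C$. To each type $A$ is associated an infinite set of variables $\mathcal V_A$, with $\mathcal V_A=\mathcal V_B$ if $A\equiv B$ and $\mathcal V_A\cap\mathcal V_B=\emptyset$ otherwise. Preterms are $r ::= x \mid \lambda x.r \mid rr \mid r\times r \mid \pi_A(r)$ (application left associative); one writes $\lambda x^A.r$ for $\lambda x.r$ when $x\in\mathcal V_A$. Introductions are abstractions and products; eliminations are applications and projections. Substitution $r[s/x]$ is as usual. Typing $r:A$ (without contexts): $x:A$ if $x\in\mathcal V_A$; if $r:A$ and $A\equiv B$ then $r:B$; if $r:B$ then $\lambda x^A.r:A\Rightarrow B$; if $r:A\Rightarrow B$ and $s:A$ then $rs:B$; if $r:A$ and $s:B$ then $r\times s:A\wedge B$; if $r:A\wedge B$ then $\pi_A(r):A$. Terms are well-typed preterms. $\rightleftarrows$ is the smallest symmetric relation, closed under all term contexts, containing $r\times s\rightleftarrows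 s\times r$, $(r\times s)\times t\rightleftarrows r\times(s\times t)$, $\lambda x^A.(r\times s)\rightleftarrows \lambda x^A.r\times\lambda x^A.s$, $rst\rightleftarrows r(s\times t)$; $\rightleftarrows^*$ is its reflexive transitive closure. Reduction: $\to_{\beta\pi\zeta}$: if $s:A$ then $(\lambda x^A.r)s\to_{\beta\pi\zeta} r[s/x]$; if $r:A$ then $\pi_A(r\times s)\to_{\beta\pi\zeta} r$; $(r\times s)t\to_{\beta\pi\zeta} rt\times st$. $\to_{\eta\delta}$: if $r:A\Rightarrow B$, $r$ is an elimination or a variable, and $x\in\mathcal V_A$ fresh, then $r\to_{\eta\delta}\lambda x^A.(rx)$; if $r:A\wedge B$ and $r$ is an elimination or a variable, then $r\to_{\eta\delta}\pi_A(r)\times\pi_B(r)$. The relations $\hookrightarrow$ and $\to$ are the smallest relations such that: $r\to_{\beta\pi\zeta}s$ implies $r\hookrightarrow s$; $r\to_{\eta\delta}s$ implies $r\to s$; $r\hookrightarrow s$ implies $r\to s$; $r\to s$ implies $\lambda x.r\hookrightarrow\lambda x.s$; $r\hookrightarrow s$ implies $rt\hookrightarrow st$; $r\to s$ implies $tr\hookrightarrow ts$, $r\times t\hookrightarrow s\times t$, $t\times r\hookrightarrow t\times s$; $r\hookrightarrow s$ implies $\pi_A(r)\hookrightarrow\pi_A(s)$. Finally $r\rightsquigarrow s$ iff $r\rightleftarrows^* r'\to s'\rightleftarrows^* s$ for some $r',s'$. *)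

(* Defs.v *)
From HB Require Import structures.
From Stdlib Require Import Relation_Operators.
From mathcomp Require Import all_boot.
From mathcomp Require Import boolp.

Set Implicit Arguments.
Unset Strict Implicit.
Unset Printing Implicit Defensive.

Local Open Scope quotient_scope.

Inductive ty : Type :=
| Tau : ty
| Arr : ty -> ty -> ty
| Conj : ty -> ty -> ty.

Declare Scope isoty_scope.
Delimit Scope isoty_scope with T.
Bind Scope isoty_scope with ty.
Notation "A ⇒ B" := (Arr A B) (at level 55, right associativity) : isoty_scope.
Notation "A ∧ B" := (Conj A B) (at level 48, left associativity) : isoty_scope.

Fixpoint ty_enc (A : ty) : GenTree.tree unit :=
  match A with
  | Tau => GenTree.Leaf tt
  | Arr A B => GenTree.Node 0 [:: ty_enc A; ty_enc B]
  | Conj A B => GenTree.Node 1 [:: ty_enc A; ty_enc B]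
  end.

Fixpoint ty_dec (t : GenTree.tree unit) : ty :=
  match t with
  | GenTree.Node 0 [:: a; b] => Arr (ty_dec a) (ty_dec b)
  | GenTree.Node _ [:: a; b] => Conj (ty_dec a) (ty_dec b)
  | _ => Tau
  end.

Lemma ty_encK : cancel ty_enc ty_dec.
Proof. by elim=> //= A -> B ->. Qed.

HB.instance Definition _ := Countable.copy ty (can_type ty_encK).

Reserved Notation "A ≡ B" (at level 70, no associativity).

Inductive tyequiv : ty -> ty -> Prop :=
| tyequiv_comm A B : (A ∧ B)%T ≡ (B ∧ A)%T
| tyequiv_assoc A B C : (A ∧ (B ∧ C))%T ≡ ((A ∧ B) ∧ C)%T
| tyequiv_dist A B C : (A ⇒ (B ∧ C))%T ≡ ((A ⇒ B) ∧ (A ⇒ C))%T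
| tyequiv_curry A B C : ((A ∧ B) ⇒ C)%T ≡ (A ⇒ B ⇒ C)%T
| tyequiv_refl A : A ≡ A
| tyequiv_sym A B : A ≡ B -> B ≡ A
| tyequiv_trans A B C : A ≡ B -> B ≡ C -> A ≡ C
| tyequiv_arr A A' B B' : A ≡ A' -> B ≡ B' -> (A ⇒ B)%T ≡ (A' ⇒ B')%T
| tyequiv_conj A A' B B' : A ≡ A' -> B ≡ B' -> (A ∧ B)%T ≡ (A' ∧ B')%T
where "A ≡ B" := (tyequiv A B).

Definition tyequivb (A B : ty) : bool := `[< A ≡ B >].

Lemma tyequivb_refl : reflexive tyequivb.
Proof. by move=> A; apply/asboolP/tyequiv_refl. Qed.

Lemma tyequivb_sym : symmetric tyequivb.
Proof. by move=> A B; apply/asboolP/asboolP; apply: tyequiv_sym. Qed.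

Lemma tyequivb_trans : transitive tyequivb.
Proof.
move=> B A C /asboolP AB /asboolP BC; apply/asboolP.
exact: tyequiv_trans AB BC.
Qed.

Canonical tyequiv_rel :=
  EquivRel tyequivb tyequivb_refl tyequivb_sym tyequivb_trans.

(* Types modulo ≡; they index the families of variables, so that V_A = V_B
   when A ≡ B, and V_A and V_B are disjoint otherwise. *)
Definition tyclass : Type := {eq_quot tyequivb}.
HB.instance Definition _ := Choice.on tyclass.

Definition cls (A : ty) : tyclass := \pi_{eq_quot tyequivb} A.

Lemma clsP (A B : ty) : cls A = cls B <-> A ≡ B.
Proof.
split=> [/eqmodP /asboolP //|AB]; exact/eqmodP/asboolP.
Qed.

(* Preterms up to renaming of bound variables, with de Bruijn indices counted
   separately in each family of variables: [Var U n] refers to the n-th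
   enclosing binder [Lam U], skipping the binders of the other classes, and is
   a free variable of V_U when there are at most n such binders. As each
   occurrence carries its class, no typing context is needed, and each V_U is
   infinite. *)
Inductive preterm : Type :=
| Var : tyclass -> nat -> preterm
| Lam : tyclass -> preterm -> preterm
| App : preterm -> preterm -> preterm
| Prod : preterm -> preterm -> preterm
| Proj : ty -> preterm -> preterm.

Declare Scope preterm_scope.
Delimit Scope preterm_scope with P.
Bind Scope preterm_scope with preterm.
Notation "r @ s" := (App r s) (at level 38, left associativity)
  : preterm_scope.
Notation "r × s" := (Prod r s) (at level 48, left associativity)
  : preterm_scope.

Definition shift (U : tyclass) (T : tyclass) (n : nat) : nat :=
  if T == U then n.+1 else n.

Definition up_ren (U : tyclass) (rho : tyclass -> nat -> nat)
    (T : tyclass) (n : nat) : nat :=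
  if T == U then (if n is m.+1 then (rho T m).+1 else 0) else rho T n.

Fixpoint rename (rho : tyclass -> nat -> nat) (r : preterm) : preterm :=
  match r with
  | Var U n => Var U (rho U n)
  | Lam U r => Lam U (rename (up_ren U rho) r)
  | App r s => App (rename rho r) (rename rho s)
  | Prod r s => Prod (rename rho r) (rename rho s)
  | Proj A r => Proj A (rename rho r)
  end.

Definition up_subst (U : tyclass) (sigma : tyclass -> nat -> preterm)
    (T : tyclass) (n : nat) : preterm :=
  if T == U then
    (if n is m.+1 then rename (shift U) (sigma T m) else Var T 0)
  else rename (shift U) (sigma T n).

Fixpoint subst (sigma : tyclass -> nat -> preterm) (r : preterm) : preterm :=
  match r with
  | Var U n => sigma U n
  | Lam U r => Lam U (subst (up_subst U sigma) r)
  | App r s => App (subst sigma r) (subst sigma s)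
  | Prod r s => Prod (subst sigma r) (subst sigma s)
  | Proj A r => Proj A (subst sigma r)
  end.

(* [instantiate U s r] is r[s/x] where r is the body of an abstraction [Lam U]
   binding x. *)
Definition instantiate (U : tyclass) (s : preterm) : preterm -> preterm :=
  subst (fun T n =>
    if T == U then (if n is m.+1 then Var T m else s) else Var T n).

Reserved Notation "r ∈ A" (at level 70, no associativity).

Inductive typing : preterm -> ty -> Prop :=
| typing_var A n : Var (cls A) n ∈ A
| typing_equiv r A B : r ∈ A -> A ≡ B -> r ∈ B
| typing_lam A B r : r ∈ B -> Lam (cls A) r ∈ (A ⇒ B)%T
| typing_app A B r s : r ∈ (A ⇒ B)%T -> s ∈ A -> (r @ s)%P ∈ B
| typing_prod A B r s : r ∈ A -> s ∈ B -> (r × s)%P ∈ (A ∧ B)%T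
| typing_proj A B r : r ∈ (A ∧ B)%T -> Proj A r ∈ A
where "r ∈ A" := (typing r A).

Definition is_elim (r : preterm) : bool :=
  match r with App _ _ | Proj _ _ => true | _ => false end.

Definition is_var (r : preterm) : bool :=
  if r is Var _ _ then true else false.

Reserved Notation "r ⇄ s" (at level 70, no associativity).

Inductive iso_step : preterm -> preterm -> Prop :=
| iso_comm r s : (r × s)%P ⇄ (s × r)%P
| iso_assoc r s t : ((r × s) × t)%P ⇄ (r × (s × t))%P
| iso_dist U r s : Lam U (r × s)%P ⇄ (Lam U r × Lam U s)%P
| iso_curry r s t : (r @ s @ t)%P ⇄ (r @ (s × t))%P
| iso_sym r s : r ⇄ s -> s ⇄ r
| iso_lam U r s : r ⇄ s -> Lam U r ⇄ Lam U s
| iso_appl r s t : r ⇄ s -> (r @ t)%P ⇄ (s @ t)%P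
| iso_appr r s t : r ⇄ s -> (t @ r)%P ⇄ (t @ s)%P
| iso_prodl r s t : r ⇄ s -> (r × t)%P ⇄ (s × t)%P
| iso_prodr r s t : r ⇄ s -> (t × r)%P ⇄ (t × s)%P
| iso_proj A r s : r ⇄ s -> Proj A r ⇄ Proj A s
where "r ⇄ s" := (iso_step r s).

Definition iso : preterm -> preterm -> Prop := clos_refl_trans preterm iso_step.

Inductive red_betapizeta : preterm -> preterm -> Prop :=
| red_beta A r s :
    s ∈ A -> red_betapizeta (Lam (cls A) r @ s)%P (instantiate (cls A) s r)
| red_pi A r s : r ∈ A -> red_betapizeta (Proj A (r × s)%P) r
| red_zeta r s t : red_betapizeta ((r × s) @ t)%P ((r @ t) × (s @ t))%P.

Inductive red_etadelta : preterm -> preterm -> Prop :=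
| red_eta A B r :
    r ∈ (A ⇒ B)%T -> is_elim r || is_var r ->
    red_etadelta r
      (Lam (cls A) (rename (shift (cls A)) r @ Var (cls A) 0)%P)
| red_delta A B r :
    r ∈ (A ∧ B)%T -> is_elim r || is_var r ->
    red_etadelta r (Proj A r × Proj B r)%P.

Reserved Notation "r ↪ s" (at level 70, no associativity).
Reserved Notation "r ⟶ s" (at level 70, no associativity).

Inductive hook : preterm -> preterm -> Prop :=
| hook_betapizeta r s : red_betapizeta r s -> r ↪ s
| hook_lam U r s : r ⟶ s -> Lam U r ↪ Lam U s
| hook_appl r s t : r ↪ s -> (r @ t)%P ↪ (s @ t)%P
| hook_appr r s t : r ⟶ s -> (t @ r)%P ↪ (t @ s)%P
| hook_prodl r s t : r ⟶ s -> (r × t)%P ↪ (s × t)%P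
| hook_prodr r s t : r ⟶ s -> (t × r)%P ↪ (t × s)%P
| hook_proj A r s : r ↪ s -> Proj A r ↪ Proj A s
with red : preterm -> preterm -> Prop :=
| red_etadelta_red r s : red_etadelta r s -> r ⟶ s
| red_hook r s : r ↪ s -> r ⟶ s
where "r ↪ s" := (hook r s)
and "r ⟶ s" := (red r s).

Definition red_mod (r s : preterm) : Prop :=
  exists r' s', [/\ iso r r', r' ⟶ s' & iso s' s].

Notation "r ⇝ s" := (red_mod r s) (at level 70, no associativity).

Definition strongly_normalising (r : preterm) : Prop :=
  ~ exists f : nat -> preterm, f 0 = r /\ forall n, f n ⇝ f n.+1.

(* Main.v *)
(* The measure of a typed term is a lexicographic pair that the isomorphisms leave
   unchanged. Its first component decreases under beta and zeta and does not
   increase under pi, eta and delta; its second component decreases under pi, eta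
   and delta.

   The first component evaluates the term in hereditarily monotone functionals
   over nat. All components of a type are merged into one functional, whose
   order is the rank of the type, and all its arguments are passed as one sum.
   Products are thus sums, [r s t] and [r (s × t)] both evaluate [r] at [s + t],
   and a projection merely forgets arguments of high rank, so it is bounded
   whichever component it selects. As in Di Cosmo and Kesner's simulation of
   expansions, a term that may be expanded where it stands is given the value of
   its complete expansion, so that expansion steps do not increase the value.

   The second component counts the remaining expansions, with weights that are
   invariant under the equivalence of types. *)
From mathcomp Require Import all_boot zify.
From mathcomp Require Import boolp.
Require Import Defs.

Set Implicit Arguments.
Unset Strict Implicit.
Unset Printing Implicit Defensive.

(** Every bookkeeping constant has to respect the four type isomorphisms. Distributivity asks that
    it add up over the conjuncts of a result, currying that it add up over successive arguments.
    This is why products of widths stand where one would simply write 1, and why the weights are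
    built on an exponential, which satisfies the same laws and still grows fast enough.

    A single lexicographic component would not do: with free variables valued 0, a projection of a
    pair of variables of type [Tau] has value 0, like its result, so pi cannot be made strict in the
    first component. The discarded factor is charged to the second one, where every term in argument
    position has positive size.

    Strictness is carried through contexts as an explicit constant [k], independent of the
    environment. Abstraction, application, truncation and expansion all preserve such a surplus. *)

Arguments tyequiv_refl {A}.
#[local] Hint Resolve tyequiv_refl : core.

(** * Types up to equivalence *)

Definition tree := GenTree.tree unit.

(** Only some total order is wanted, so that sorting turns multisets of trees into canonical
    lists. *)
Definition tree_le (t u : tree) := pickle t <= pickle u.

Lemma tree_le_total : total tree_le.
Proof. by move=> t u; exact: leq_total. Qed.

Lemma tree_le_trans : transitive tree_le.
Proof. by move=> u t w; exact: leq_trans. Qed.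

Lemma tree_le_anti : antisymmetric tree_le.
Proof.
move=> t u; rewrite /tree_le -eqn_leq => /eqP.
exact: (pcan_inj pickleK).
Qed.

Definition tsort := sort tree_le.

Lemma tsortP l l' : reflect (tsort l = tsort l') (perm_eq l l').
Proof. exact: perm_sortP tree_le_total tree_le_trans tree_le_anti l l'. Qed.

Lemma tsortK l : tsort (tsort l) = tsort l.
Proof. by apply/tsortP; rewrite /tsort perm_sort. Qed.

Definition children (t : tree) : seq tree :=
  if t is GenTree.Node _ l then l else [::].

Definition add_children (l : seq tree) (t : tree) : tree :=
  GenTree.Node 0 (tsort (l ++ children t)).

(* Up to equivalence a type is a nonempty multiset of arrows into [Tau], each given
   in turn by the multiset of the components of its arguments: a tree with sorted
   children. *)
Fixpoint nf (A : ty) : seq tree :=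
  match A with
  | Tau => [:: GenTree.Node 0 [::]]
  | Arr A B => map (add_children (nf A)) (nf B)
  | Conj A B => nf A ++ nf B
  end.

(** Sortedness at the root is what [add_children_inj] uses when it cancels [l]. *)
Definition canonical_tree (t : tree) : bool :=
  t == GenTree.Node 0 (tsort (children t)).

Lemma nf_canonical A : all canonical_tree (nf A).
Proof.
elim: A => [|A _ B _|A IHA B IHB] //=; last by rewrite all_cat IHA.
by rewrite all_map; apply/allP => t _ /=; rewrite /canonical_tree /= tsortK.
Qed.

Lemma nf_neq0 A : nf A != [::].
Proof. by elim: A => //= [A _ B|A IHA B _]; [case: (nf B)|case: (nf A) IHA]. Qed.

Lemma add_children_perm l l' : perm_eq l l' -> add_children l =1 add_children l'.
Proof. by move=> ll' t; congr GenTree.Node; apply/tsortP; rewrite perm_cat2r. Qed.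

Lemma add_children_inj l t u : canonical_tree t -> canonical_tree u ->
  add_children l t = add_children l u -> t = u.
Proof.
move=> /eqP -> /eqP -> [] /tsortP; rewrite perm_cat2l /= => /tsortP.
by rewrite !tsortK => ->.
Qed.

(** With [ty_of_nf] and [ty_of_seq_perm] this makes [nf] a complete invariant of types. Equivalences
    are inverted through it, since transitivity blocks a direct induction on [tyequiv]. *)
Lemma nf_equiv A B : A ≡ B -> perm_eq (nf A) (nf B).
Proof.
elim=> {A B} //=.
- by move=> A B; rewrite perm_catC.
- by move=> A B C; rewrite catA.
- by move=> A B C; rewrite map_cat.
- move=> A B C; rewrite -map_comp; set s := map _ _; suff -> : s = map (add_children (nf A) \o add_children (nf B)) (nf C) by [].
  apply: eq_map => t /=; congr GenTree.Node; apply/tsortP => /=.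
  by rewrite -catA perm_cat2l perm_sym /tsort perm_sort.
- by move=> A B _; rewrite perm_sym.
- by move=> A B C _ AB _; apply: perm_trans.
- move=> A A' B B' _ AA' _ BB'.
  by rewrite (eq_map (add_children_perm AA')) perm_map.
- by move=> A A' B B' _ AA' _ BB'; apply: perm_cat.
Qed.

Fixpoint ty_of_tree (t : tree) : ty :=
  if t is GenTree.Node _ l then foldr (fun u => Arr (ty_of_tree u)) Tau l else Tau.

(** There is no empty conjunction: [Tau] is a dummy on the empty list, whence the nonemptiness
    hypotheses below. *)
Fixpoint ty_of_seq (l : seq tree) : ty :=
  match l with
  | [::] => Tau
  | [:: t] => ty_of_tree t
  | t :: l => Conj (ty_of_tree t) (ty_of_seq l)
  end.

Lemma ty_of_seq_cons t l : l != [::] ->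
  ty_of_seq (t :: l) = Conj (ty_of_tree t) (ty_of_seq l).
Proof. by case: l. Qed.

Definition arrs (l : seq tree) (C : ty) := foldr (fun u => Arr (ty_of_tree u)) C l.

Lemma ty_of_tree_children t : ty_of_tree t = arrs (children t) Tau.
Proof. by case: t. Qed.

Lemma arrs_cat l l' C : arrs (l ++ l') C = arrs l (arrs l' C).
Proof. exact: foldr_cat. Qed.

Lemma arr_swap A B C : Arr A (Arr B C) ≡ Arr B (Arr A C).
Proof.
apply: tyequiv_trans (tyequiv_sym (tyequiv_curry _ _ _)) _.
apply: tyequiv_trans (tyequiv_curry _ _ _).
by apply: tyequiv_arr tyequiv_refl; exact: tyequiv_comm.
Qed.

Lemma arr_arrs A l C : Arr A (arrs l C) ≡ arrs l (Arr A C).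
Proof.
elim: l => [|t l IHl] /=; first exact: tyequiv_refl.
apply: tyequiv_trans (arr_swap _ _ _) _.
by apply: tyequiv_arr; [exact: tyequiv_refl|exact: IHl].
Qed.

Lemma arrs_perm l l' C : perm_eq l l' -> arrs l C ≡ arrs l' C.
Proof.
move=> ll'; apply: (catCA_perm_ind (P := fun l' => arrs l C ≡ arrs l' C)) ll' _;
  last exact: tyequiv_refl.
move=> s1 s2 s3 H; apply: tyequiv_trans H _; rewrite !arrs_cat.
elim: s1 => [|t s1 IH] /=; first exact: tyequiv_refl.
apply: tyequiv_trans (arr_arrs _ _ _).
by apply: tyequiv_arr; [exact: tyequiv_refl|exact: IH].
Qed.

Lemma ty_of_seq_cat l l' : l != [::] -> l' != [::] ->
  ty_of_seq (l ++ l') ≡ Conj (ty_of_seq l) (ty_of_seq l').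
Proof.
elim: l => // t l IH _ l'0; have [->|l0] := eqVneq l [::].
  by rewrite cat1s ty_of_seq_cons //; exact: tyequiv_refl.
rewrite cat_cons !ty_of_seq_cons //; last by case: (l) l0.
apply: tyequiv_trans (tyequiv_assoc _ _ _).
by apply: tyequiv_conj; [exact: tyequiv_refl|exact: IH].
Qed.

Lemma ty_of_seq_perm l l' : perm_eq l l' -> ty_of_seq l ≡ ty_of_seq l'.
Proof.
move=> ll'.
apply: (catCA_perm_ind (P := fun l' => ty_of_seq l ≡ ty_of_seq l')) ll' _;
  last exact: tyequiv_refl.
move=> s1 s2 s3 H; apply: tyequiv_trans H _.
have [->|s1N] := eqVneq s1 [::]; first exact: tyequiv_refl.
have [->|s2N] := eqVneq s2 [::]; first exact: tyequiv_refl.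
have C12 : ty_of_seq (s1 ++ s2) ≡ ty_of_seq (s2 ++ s1).
  apply: tyequiv_trans (ty_of_seq_cat s1N s2N) _.
  apply: tyequiv_trans (tyequiv_comm _ _) _.
  exact/tyequiv_sym/ty_of_seq_cat.
have [->|s3N] := eqVneq s3 [::]; first by rewrite !cats0.
rewrite !catA.
apply: tyequiv_trans (ty_of_seq_cat _ s3N) _; first by case: (s1) s1N.
apply: tyequiv_trans (tyequiv_conj C12 tyequiv_refl) _.
apply/tyequiv_sym/ty_of_seq_cat => //; by case: (s2) s2N.
Qed.

Lemma arrs_ty_of_seq l C : l != [::] -> arrs l C ≡ Arr (ty_of_seq l) C.
Proof.
elim: l => // t l IH _; have [->|lN] := eqVneq l [::]; first exact: tyequiv_refl.
rewrite ty_of_seq_cons //=.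
apply: tyequiv_trans (tyequiv_arr tyequiv_refl (IH lN)) _.
exact/tyequiv_sym/tyequiv_curry.
Qed.

Lemma ty_of_seq_map l l' : l != [::] -> l' != [::] ->
  ty_of_seq (map (add_children l) l') ≡ Arr (ty_of_seq l) (ty_of_seq l').
Proof.
move=> lN; have T t : ty_of_tree (add_children l t) ≡ Arr (ty_of_seq l) (ty_of_tree t).
  rewrite ty_of_tree_children /=.
  apply: tyequiv_trans (arrs_perm (l' := l ++ children t) _ _) _.
    by rewrite /tsort perm_sort.
  by rewrite arrs_cat -ty_of_tree_children; exact: arrs_ty_of_seq.
elim: l' => // t l' IH _; have [->|l'N] := eqVneq l' [::]; first exact: T.
rewrite map_cons !ty_of_seq_cons //; last by case: (l') l'N.
apply: tyequiv_trans (tyequiv_conj (T t) (IH l'N)) _.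
exact/tyequiv_sym/tyequiv_dist.
Qed.

Lemma ty_of_nf A : A ≡ ty_of_seq (nf A).
Proof.
elim: A => [|A IHA B IHB|A IHA B IHB] /=; first exact: tyequiv_refl.
  apply: tyequiv_trans (tyequiv_arr IHA IHB) _.
  by apply/tyequiv_sym/ty_of_seq_map; exact: nf_neq0.
apply: tyequiv_trans (tyequiv_conj IHA IHB) _.
by apply/tyequiv_sym/ty_of_seq_cat; exact: nf_neq0.
Qed.

(** On canonical trees [add_children l] is injective, so mapping it preserves every multiplicity. *)
Lemma add_children_map_inj l s s' :
  all canonical_tree s -> all canonical_tree s' ->
  perm_eq (map (add_children l) s) (map (add_children l) s') -> perm_eq s s'.
Proof.
move=> cs cs' /permP P; apply/allP => t; rewrite mem_cat => ts; apply/eqP.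
have ct : canonical_tree t by case/orP: ts => H; [apply: (allP cs)|apply: (allP cs')].
have E s0 : all canonical_tree s0 ->
    count_mem t s0 = count_mem (add_children l t) (map (add_children l) s0).
  move=> c0; rewrite count_map; apply: eq_in_count => u /(allP c0) cu /=.
  by apply/eqP/eqP => [->|/add_children_inj -> //].
by rewrite !E.
Qed.

(** For uniqueness of types: two typings of an application yield equivalent arrows with equivalent
    sources, and their targets must then agree. *)
Lemma arr_cancel A B C : Arr A B ≡ Arr A C -> B ≡ C.
Proof.
move=> /nf_equiv /= /add_children_map_inj H.
apply: tyequiv_trans (ty_of_nf B) _.
apply: tyequiv_trans (tyequiv_sym (ty_of_nf C)).
by apply: ty_of_seq_perm; apply: H; exact: nf_canonical.
Qed.

Lemma subset_map_ex (T U : eqType) (f : T -> U) (l : seq U) (s : seq T) :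
  {subset l <= map f s} -> exists2 c, l = map f c & {subset c <= s}.
Proof.
elim: l => [|u l IH] H; first by exists [::].
have [c -> cs] : exists2 c, l = map f c & {subset c <= s}.
  by apply: IH => v vl; apply: H; rewrite inE vl orbT.
have /mapP[t ts ->] : u \in map f s by apply: H; rewrite inE eqxx.
by exists (t :: c) => // x; rewrite inE => /orP[/eqP ->|/cs].
Qed.

(** For zeta, where a product is typed by an arrow. All trees of [nf R] and [nf S] lie in the image
    of [add_children (nf A)]; their preimages split [nf B] into the two wanted halves. *)
Lemma conj_arr_split R S A B : Conj R S ≡ Arr A B ->
  exists C D, [/\ B ≡ Conj C D, R ≡ Arr A C & S ≡ Arr A D].
Proof.
move=> /nf_equiv /= P.
have [|c Ec cB] := @subset_map_ex _ _ (add_children (nf A)) (nf R) (nf B).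
  by move=> x xR; rewrite -(perm_mem P) mem_cat xR.
have [|d Ed dB] := @subset_map_ex _ _ (add_children (nf A)) (nf S) (nf B).
  by move=> x xS; rewrite -(perm_mem P) mem_cat xS orbT.
have cN : c != [::] by have := nf_neq0 R; rewrite Ec; case: (c).
have dN : d != [::] by have := nf_neq0 S; rewrite Ed; case: (d).
have can s : {subset s <= nf B} -> all canonical_tree s.
  by move=> sB; apply/allP => x /sB; exact/allP/nf_canonical.
have X C l : nf C = map (add_children (nf A)) l -> l != [::] -> C ≡ Arr A (ty_of_seq l).
  move=> EC lN; apply: tyequiv_trans (ty_of_nf _) _; rewrite EC.
  apply: tyequiv_trans (ty_of_seq_map (nf_neq0 A) lN) _.
  by apply: tyequiv_arr; [apply/tyequiv_sym/ty_of_nf|exact: tyequiv_refl].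
exists (ty_of_seq c), (ty_of_seq d); split; [|exact: X|exact: X].
apply: tyequiv_trans (ty_of_nf _) _.
apply: tyequiv_trans (ty_of_seq_cat cN dN).
apply: ty_of_seq_perm; rewrite perm_sym.
apply: (@add_children_map_inj (nf A)); last by rewrite map_cat -Ec -Ed.
  by rewrite all_cat !can.
exact: nf_canonical.
Qed.

(** * Typing *)

Lemma typing_var_inv U n C : Var U n ∈ C -> U = cls C.
Proof.
move e: (Var U n) => r rC; elim: rC e => //{r C}.
  by move=> A m [->].
by move=> r A B _ IH AB /IH ->; apply/clsP.
Qed.

Lemma typing_lam_inv U r C : Lam U r ∈ C ->
  exists A B, [/\ U = cls A, r ∈ B & Arr A B ≡ C].
Proof.
move e: (Lam U r) => t tC; elim: tC r e => //{t C}.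
  move=> t A B _ IH AB r /IH[A' [B' [? ? E]]]; exists A', B'; split=> //.
  exact: tyequiv_trans E AB.
by move=> A B t tB _ r [-> ->]; exists A, B; split=> //; exact: tyequiv_refl.
Qed.

Lemma typing_app_inv r s C : (r @ s)%P ∈ C -> exists2 A, r ∈ Arr A C & s ∈ A.
Proof.
move e: (r @ s)%P => t tC; elim: tC r s e => //{t C}.
  move=> t A B _ IH AB r s /IH[A' rA sA]; exists A' => //.
  by apply: typing_equiv rA _; apply: tyequiv_arr.
by move=> A B t u tAB _ uA _ r s [-> ->]; exists A.
Qed.

Lemma typing_prod_inv r s C : (r × s)%P ∈ C ->
  exists A B, [/\ r ∈ A, s ∈ B & Conj A B ≡ C].
Proof.
move e: (r × s)%P => t tC; elim: tC r s e => //{t C}.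
  move=> t A B _ IH AB r s /IH[A' [B' [? ? E]]]; exists A', B'; split=> //.
  exact: tyequiv_trans E AB.
move=> A B t u tAB _ uA _ r s [-> ->]; exists A, B; split=> //.
Qed.

Lemma typing_proj_inv A r C : Proj A r ∈ C -> A ≡ C /\ exists B, r ∈ Conj A B.
Proof.
move e: (Proj A r) => t tC; elim: tC A r e => //{t C}.
  by move=> t A B _ IH AB A' r /IH[E ?]; split=> //; exact: tyequiv_trans E AB.
by move=> A B t tAB _ A' r [-> ->]; split; [exact: tyequiv_refl|exists B].
Qed.

Lemma typing_unique r A B : r ∈ A -> r ∈ B -> A ≡ B.
Proof.
elim: r A B => [U n|U r IH|r IHr s IHs|r IHr s IHs|C r IH] A B.
- by move=> /typing_var_inv -> /typing_var_inv/clsP.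
- move=> /typing_lam_inv[A1 [B1 [-> r1 E1]]] /typing_lam_inv[A2 [B2 [/clsP E r2 E2]]].
  apply: tyequiv_trans (tyequiv_sym E1) _; apply: tyequiv_trans E2.
  by apply: tyequiv_arr E (IH _ _ r1 r2).
- move=> /typing_app_inv[A1 r1 s1] /typing_app_inv[A2 r2 s2].
  apply: (@arr_cancel A1); apply: tyequiv_trans (IHr _ _ r1 r2) _.
  by apply: tyequiv_arr tyequiv_refl; exact: IHs s2 s1.
- move=> /typing_prod_inv[A1 [B1 [r1 s1 E1]]] /typing_prod_inv[A2 [B2 [r2 s2 E2]]].
  apply: tyequiv_trans (tyequiv_sym E1) _; apply: tyequiv_trans E2.
  by apply: tyequiv_conj; [exact: IHr|exact: IHs].
- move=> /typing_proj_inv[E1 _] /typing_proj_inv[E2 _].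
  exact: tyequiv_trans (tyequiv_sym E1) E2.
Qed.

Lemma typing_rename f r A : r ∈ A -> rename f r ∈ A.
Proof.
move=> rA; elim: rA f => {r A} /=.
- by move=> A n f; exact: typing_var.
- by move=> r A B _ IH AB f; apply: typing_equiv AB.
- by move=> A B r _ IH f; apply: typing_lam.
- by move=> A B r s _ IHr _ IHs f; apply: typing_app (IHs f).
- by move=> A B r s _ IHr _ IHs f; apply: typing_prod.
- by move=> A B r _ IH f; apply: typing_proj.
Qed.

Definition typing_subst_map (sigma : tyclass -> nat -> preterm) : Prop :=
  forall A n, sigma (cls A) n ∈ A.

Lemma typing_up_subst U sigma :
  typing_subst_map sigma -> typing_subst_map (up_subst U sigma).
Proof.
move=> sP A n; rewrite /up_subst; case: eqP => [_|_]; last exact: typing_rename.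
by case: n => [|n]; [exact: typing_var|exact: typing_rename].
Qed.

Lemma typing_subst sigma r A : typing_subst_map sigma -> r ∈ A -> subst sigma r ∈ A.
Proof.
move=> sP rA; elim: rA sigma sP => {r A} /=.
- by move=> A n s.
- by move=> r A B _ IH AB s sP; apply: typing_equiv AB; exact: IH.
- by move=> A B r _ IH s sP; apply: typing_lam; apply: IH; exact: typing_up_subst.
- by move=> A B r t _ IHr _ IHt s sP; apply: typing_app (IHt s sP); exact: IHr.
- by move=> A B r t _ IHr _ IHt s sP; apply: typing_prod; auto.
- by move=> A B r _ IH s sP; apply: typing_proj; exact: IH.
Qed.

(** The map inside [instantiate], named so that the substitution lemmas can be applied to it. *)
Definition single (U : tyclass) (s : preterm) (T : tyclass) (n : nat) : preterm :=
  if T == U then (if n is m.+1 then Var T m else s) else Var T n.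

Lemma typing_single A s : s ∈ A -> typing_subst_map (single (cls A) s).
Proof.
move=> sA B n; rewrite /single; case: eqP => [/clsP BA|_]; last exact: typing_var.
case: n => [|n]; last exact: typing_var.
exact: typing_equiv sA (tyequiv_sym BA).
Qed.

Lemma typing_iso_step r s A : r ⇄ s -> r ∈ A <-> s ∈ A.
Proof.
move=> rs; elim: rs A => {r s}.
- have H r s A : (r × s)%P ∈ A -> (s × r)%P ∈ A.
    move=> /typing_prod_inv[B [C [rB sC E]]].
    apply: typing_equiv (typing_prod sC rB) _.
    exact: tyequiv_trans (tyequiv_comm _ _) E.
  by move=> r s A; split; exact: H.
- move=> r s t A; split.
    move=> /typing_prod_inv[X [C [/typing_prod_inv[A' [B [rA sB E1]]] tC E2]]].
    apply: typing_equiv (typing_prod rA (typing_prod sB tC)) _.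
    apply: tyequiv_trans (tyequiv_assoc _ _ _) _; apply: tyequiv_trans E2.
    by apply: tyequiv_conj E1 tyequiv_refl.
  move=> /typing_prod_inv[A' [X [rA /typing_prod_inv[B [C [sB tC E1]]] E2]]].
  apply: typing_equiv (typing_prod (typing_prod rA sB) tC) _.
  apply: tyequiv_trans (tyequiv_sym (tyequiv_assoc _ _ _)) _; apply: tyequiv_trans E2.
  by apply: tyequiv_conj tyequiv_refl E1.
- move=> U r s A; split.
    move=> /typing_lam_inv[X [Y [-> /typing_prod_inv[B [C [rB sC E1]]] E2]]].
    apply: typing_equiv (typing_prod (typing_lam X rB) (typing_lam X sC)) _.
    apply: tyequiv_trans (tyequiv_sym (tyequiv_dist _ _ _)) _; apply: tyequiv_trans E2.
    by apply: tyequiv_arr tyequiv_refl E1.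
  move=> /typing_prod_inv[B [C [/typing_lam_inv[X [Y [-> rY E1]]]
    /typing_lam_inv[X' [Y' [/clsP E rY' E2]]] E3]]].
  apply: typing_equiv (typing_lam X (typing_prod rY rY')) _.
  apply: tyequiv_trans (tyequiv_dist _ _ _) _; apply: tyequiv_trans E3.
  apply: tyequiv_conj E1 _; apply: tyequiv_trans E2.
  by apply: tyequiv_arr E tyequiv_refl.
- move=> r s t A; split.
    move=> /typing_app_inv[B /typing_app_inv[C rC sC] tB].
    apply: typing_app (typing_prod sC tB); apply: typing_equiv rC _.
    exact/tyequiv_sym/tyequiv_curry.
  move=> /typing_app_inv[B rB /typing_prod_inv[C [D [sC tD E]]]].
  apply: typing_app tD; apply: typing_app sC; apply: typing_equiv rB _.
  apply: tyequiv_trans (tyequiv_curry _ _ _).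
  by apply: tyequiv_arr (tyequiv_sym E) tyequiv_refl.
- by move=> r s _ IH A; rewrite IH.
- move=> U r s _ IH A; split=> /typing_lam_inv[B [C [-> /IH sC E]]];
    exact: typing_equiv (typing_lam B sC) E.
- move=> r s t _ IH A.
  by split=> /typing_app_inv[B /IH rB tB]; exact: typing_app tB.
- move=> r s t _ IH A.
  by split=> /typing_app_inv[B rB /IH tB]; exact: typing_app tB.
- move=> r s t _ IH A.
  by split=> /typing_prod_inv[B [C [/IH rB sC E]]]; apply: typing_equiv E; exact: typing_prod.
- move=> r s t _ IH A.
  by split=> /typing_prod_inv[B [C [rB /IH sC E]]]; apply: typing_equiv E; exact: typing_prod.
- move=> B r s _ IH A.
  by split=> /typing_proj_inv[E [C /IH rC]]; apply: typing_equiv E; exact: typing_proj rC.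
Qed.

Lemma typing_lam_beta A B r : Lam (cls A) r ∈ Arr A B -> r ∈ B.
Proof.
move=> /typing_lam_inv[A' [B' [/clsP AA' rB' E]]].
apply: typing_equiv rB' _; apply: (@arr_cancel A).
by apply: tyequiv_trans E; exact: tyequiv_arr.
Qed.

Lemma typing_betapizeta r s A : red_betapizeta r s -> r ∈ A -> s ∈ A.
Proof.
case=> {r s}.
- move=> B r s sB /typing_app_inv[B' rA sB'].
  apply: typing_subst (typing_single sB) _; apply: typing_lam_beta => //.
  apply: typing_equiv rA _; apply: tyequiv_arr tyequiv_refl; exact: typing_unique sB' sB.
- move=> B r s rB /typing_proj_inv[E _]; exact: typing_equiv E.
- move=> r s t /typing_app_inv[B /typing_prod_inv[R [S [rR sS E]]] tB].
  have [C [D [AE RE SE]]] := conj_arr_split E.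
  apply: typing_equiv (tyequiv_sym AE); apply: typing_prod.
    exact: typing_app (typing_equiv rR RE) tB.
  exact: typing_app (typing_equiv sS SE) tB.
Qed.

Lemma typing_etadelta r s A : red_etadelta r s -> r ∈ A -> s ∈ A.
Proof.
case=> {r s} [B C r rBC _ rA|B C r rBC _ rA].
  apply: typing_equiv (typing_unique rBC rA).
  by apply: typing_lam; apply: typing_app (typing_rename _ rBC) (typing_var _ _).
apply: typing_equiv (typing_unique rBC rA).
apply: typing_prod; first exact: typing_proj rBC.
by apply: typing_proj (typing_equiv rBC (tyequiv_comm _ _)).
Qed.

Scheme hook_ind2 := Induction for hook Sort Prop
with red_ind2 := Induction for red Sort Prop.
Combined Scheme hook_red_ind from hook_ind2, red_ind2.

Lemma typing_hook_red :
  (forall r s, r ↪ s -> forall A, r ∈ A -> s ∈ A) /\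
  (forall r s, r ⟶ s -> forall A, r ∈ A -> s ∈ A).
Proof.
apply: hook_red_ind => //.
- by move=> r s rs A; exact: typing_betapizeta.
- move=> U r s _ IH A /typing_lam_inv[B [C [-> /IH sC E]]].
  exact: typing_equiv (typing_lam B sC) E.
- by move=> r s t _ IH A /typing_app_inv[B /IH rB tB]; exact: typing_app tB.
- by move=> r s t _ IH A /typing_app_inv[B rB /IH tB]; exact: typing_app tB.
- move=> r s t _ IH A /typing_prod_inv[B [C [/IH rB sC E]]].
  by apply: typing_equiv E; exact: typing_prod.
- move=> r s t _ IH A /typing_prod_inv[B [C [rB /IH sC E]]].
  by apply: typing_equiv E; exact: typing_prod.
- move=> B r s _ IH A /typing_proj_inv[E [C /IH rC]].
  by apply: typing_equiv E; exact: typing_proj rC.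
- by move=> r s rs A; exact: typing_etadelta.
Qed.

Definition canon (A : ty) : ty := repr (cls A).

Lemma canon_equiv A : canon A ≡ A.
Proof. by apply/clsP; rewrite /cls /canon reprK. Qed.

Lemma canonP A B : A ≡ B -> canon A = canon B.
Proof. by move=> /clsP; rewrite /canon => ->. Qed.

(** The values are defined by recursion on preterms and must look types up. Choosing a class
    representative turns equivalence of types into equality; [Tau] is a dummy for untypable
    preterms. *)
Definition type_of (r : preterm) : ty :=
  if pselect (exists A, r ∈ A) is left H then canon (projT1 (cid H)) else Tau.

Lemma type_ofE r A : r ∈ A -> type_of r = canon A.
Proof.
move=> rA; rewrite /type_of; case: pselect => [H|[]]; last by exists A.
by apply: canonP; exact: typing_unique (projT2 (cid H)) rA.
Qed.


(** * Hereditarily monotone functionals *)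

(** The pure types over [nat], as in the theory of finite-type functionals. *)
Fixpoint D (n : nat) : Type := if n is m.+1 then D m -> nat else nat.

Definition dcst n : nat -> D n :=
  if n is m.+1 return nat -> D n then fun k _ => k else id.

Definition dadd n : D n -> D n -> D n :=
  if n is m.+1 return D n -> D n -> D n then fun f g c => f c + g c else addn.

(** The usual retractions between pure types. Both directions are defined together because arguments
    are cast contravariantly; going down to level 0 evaluates at the argument 0. *)
Fixpoint casts (m n : nat) : (D m -> D n) * (D n -> D m) :=
  match m, n return (D m -> D n) * (D n -> D m) with
  | 0, 0 => (id, id)
  | 0, n'.+1 => (fun k _ => k, fun g => g (dcst n' 0))
  | m'.+1, 0 => (fun f => f (dcst m' 0), fun k _ => k)
  | m'.+1, n'.+1 =>
    (fun f c => f ((casts m' n').2 c), fun g c => g ((casts m' n').1 c))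
  end.

Definition cast m n : D m -> D n := (casts m n).1.

Lemma castsC m n : (casts m n).2 = (casts n m).1.
Proof.
suff: (casts m n).2 = (casts n m).1 /\ (casts m n).1 = (casts n m).2 by case.
elim: m n => [|m IH] [|n] //=; have [E1 E2] := IH n.
by split; apply/funext => f; rewrite ?E1 ?E2.
Qed.

Lemma castSS m n (f : D m.+1) : cast n.+1 f = fun c => f (cast m c).
Proof. by rewrite /cast /= castsC. Qed.

Lemma cast_cst m n k : cast n (dcst m k) = dcst n k.
Proof. by case: m n => [|m] [|n] //; rewrite castSS. Qed.

Lemma cast_add m n (x y : D m) : cast n (dadd x y) = dadd (cast n x) (cast n y).
Proof. by case: m n x y => [|m] [|n]. Qed.

(* The inner cast may lose information, but only beyond what the outer one
   keeps. *)
Lemma cast_cast m n p (x : D m) : minn m p <= n -> cast p (cast n x) = cast p x.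
Proof.
elim: n m p x => [|n IH] [|m] [|p] x //= H.
- by rewrite minnSS in H.
- by change (cast n.+1 x (dcst n 0) = x (dcst m 0)); rewrite castSS cast_cst.
- rewrite !castSS; apply/funext => c; congr x; apply: IH.
  by rewrite minnC; move: H; rewrite minnSS.
Qed.

Lemma cast_id n (x : D n) : cast n x = x.
Proof. by elim: n x => // n IH x; rewrite castSS; apply/funext => c; rewrite IH. Qed.

(* Reflexive only on hereditarily monotone elements. *)
Fixpoint leD n : D n -> D n -> Prop :=
  if n is m.+1 return D n -> D n -> Prop then
    fun f g => forall c c', leD c c' ->
      [/\ f c <= f c', g c <= g c', f c <= g c & f c' <= g c']
  else fun x y => x <= y.

Lemma leD_refl n (x y : D n) : leD x y -> leD x x /\ leD y y.
Proof.
case: n x y => [|n] f g /= H; first by rewrite !leqnn.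
by split=> c c' /H[].
Qed.

Lemma leD_trans n (x y z : D n) : leD x y -> leD y z -> leD x z.
Proof.
case: n x y z => [|n] f g h /=; first exact: leq_trans.
move=> fg gh c c' cc'; have [? _ ? ?] := fg _ _ cc'; have [_ ? ? ?] := gh _ _ cc'.
by split=> //; [apply: leq_trans (g c) _ _ _ _|apply: leq_trans (g c') _ _ _ _].
Qed.

Lemma leD_add n (x y x' y' : D n) : leD x y -> leD x' y' ->
  leD (dadd x x') (dadd y y').
Proof.
case: n x y x' y' => [|n] f g f' g' /=; first exact: leq_add.
move=> fg fg' c c' cc'; have [? ? ? ?] := fg _ _ cc'; have [? ? ? ?] := fg' _ _ cc'.
by split; apply: leq_add.
Qed.

Lemma leD_cst n k l : k <= l -> leD (dcst n k) (dcst n l).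
Proof. by case: n. Qed.

Lemma leD_cast m n (x y : D m) : leD x y -> leD (cast n x) (cast n y).
Proof.
suff: (forall x y : D m, leD x y -> leD (cast n x) (cast n y)) /\
      (forall x y : D n, leD x y -> leD (cast m x) (cast m y)) by case=> H _ /H.
elim: m n {x y} => [|m IH] [|n]; split=> // x y.
- by move=> /= /(_ (dcst n 0) (dcst n 0) (leD_cst n (leqnn 0)))[].
- by move=> /= /(_ (dcst m 0) (dcst m 0) (leD_cst m (leqnn 0)))[].
- by rewrite !castSS => /= xy c c' cc'; apply: xy; apply: (IH n).2.
- by rewrite !castSS => /= xy c c' cc'; apply: xy; apply: (IH n).1.
Qed.

Lemma leD0 n (x : D n) : leD x x -> leD (dcst n 0) x.
Proof. by case: n x => // n f H c c' /H[]. Qed.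

(** A detour through a lower level replaces the arguments by smaller ones, in the end by 0, and a
    monotone functional can only decrease. *)
Lemma leD_castK m n (x : D n) : leD x x -> leD (cast n (cast m x)) x.
Proof.
elim: m n x => [|m IH] [|n] x //.
- move=> H c c' cc'; have [cc c'c'] := leD_refl cc'.
  have [H1 _ _ _] := H _ _ cc'.
  have [H2 _ _ _] := H _ _ (leD0 cc); have [H3 _ _ _] := H _ _ (leD0 c'c').
  by split; [exact: leqnn|exact: H1|exact: H2|exact: H3].
- rewrite !castSS => /= H c c' cc'; have [cc c'c'] := leD_refl cc'.
  have [? _ _ _] := H _ _ cc'; have [? _ _ _] := H _ _ (IH _ _ cc).
  have [? _ _ _] := H _ _ (IH _ _ c'c').
  have [? _ _ _] := H _ _ (leD_cast n (leD_cast m cc')).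
  by split.
Qed.

(* A value of some type, seen at all levels at once. *)
Definition E := forall n, D n.

Definition ecst k : E := fun n => dcst n k.
Definition eadd (d e : E) : E := fun n => dadd (d n) (e n).
Notation "d ⊕ e" := (eadd d e) (at level 50, left associativity).

Lemma eaddA d e f : d ⊕ (e ⊕ f) = d ⊕ e ⊕ f.
Proof.
apply/functional_extensionality_dep => -[|n]; first exact: addnA.
by apply/funext => c; exact: addnA.
Qed.

Lemma eaddC d e : d ⊕ e = e ⊕ d.
Proof.
apply/functional_extensionality_dep => -[|n]; first exact: addnC.
by apply/funext => c; exact: addnC.
Qed.

Lemma eaddACA d e f g : (d ⊕ e) ⊕ (f ⊕ g) = (d ⊕ f) ⊕ (e ⊕ g).
Proof. by rewrite !eaddA -(eaddA d e f) (eaddC e f) eaddA. Qed.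

Lemma eadd0 d : d ⊕ ecst 0 = d.
Proof.
apply/functional_extensionality_dep => -[|n]; first exact: addn0.
by apply/funext => c; exact: addn0.
Qed.

Lemma eadd_cst k l : ecst k ⊕ ecst l = ecst (k + l).
Proof. by apply/functional_extensionality_dep => -[|n]. Qed.

Definition inj k (x : D k) : E := fun n => cast n x.

(* [tr k d] keeps the levels of [d] below [k]; [tr k d = d] says that [d] is
   determined by these levels. *)
Definition tr k (d : E) : E := if k is m.+1 then inj (d m) else ecst 0.

Lemma tr_add k d e : tr k (d ⊕ e) = tr k d ⊕ tr k e.
Proof.
case: k => [|k] /=; first by rewrite eadd_cst.
by apply/functional_extensionality_dep => n; exact: cast_add.
Qed.

Lemma tr_cst k l : tr k.+1 (ecst l) = ecst l.
Proof. by apply/functional_extensionality_dep => n; exact: cast_cst. Qed.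

Lemma inj_cst0 n : inj (dcst n 0) = ecst 0.
Proof. exact: tr_cst n 0. Qed.

Lemma tr0 k : tr k (ecst 0) = ecst 0.
Proof. by case: k => // k; exact: tr_cst. Qed.

Lemma tr_inj k m (x : D m) : m <= k -> tr k.+1 (inj x) = inj x.
Proof.
move=> mk; apply/functional_extensionality_dep => n; apply: cast_cast.
by rewrite geq_min mk.
Qed.

Lemma tr_trW k l d : k <= l -> tr l (tr k d) = tr k d.
Proof. by case: k => [|k]; [rewrite tr0|case: l => // l kl; exact: (@tr_inj l k)]. Qed.

Lemma trK k d : tr k (tr k d) = tr k d.
Proof. exact: tr_trW. Qed.

Lemma tr_weaken k l d : k <= l -> tr k d = d -> tr l d = d.
Proof. by move=> kl <-; exact: tr_trW. Qed.

Lemma levelE b d m n : tr b d = d -> m <= n -> d m = cast m (d n).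
Proof.
case: b => [<- _|b <- mn] /=; first exact/esym/cast_cst.
by rewrite cast_cast // geq_min mn orbT.
Qed.

Lemma levelE_up b d m n : tr b.+1 d = d -> b <= n -> d m = cast m (d n).
Proof. by move=> <- bn /=; rewrite cast_cast // geq_min bn. Qed.

Lemma tr_tr b k l d : tr b d = d -> k <= l -> tr k (tr l d) = tr k d.
Proof.
case: k l => [|k] [|l] // dP kl; apply/functional_extensionality_dep => n /=.
by rewrite /inj -(levelE dP).
Qed.

(* [ev b d e] evaluates the value [d] of rank [b] completely, at the tuple of
   arguments [e]. *)
Definition evD b : D b -> E -> nat :=
  if b is k.+1 return D b -> E -> nat then fun f e => f (e k) else fun k _ => k.
Definition ev b (d e : E) : nat := evD (d b) e.

Definition mkD b (F : E -> nat) : D b :=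
  if b is k.+1 return D b then fun c => F (inj c) else F (ecst 0).
Definition mk b (F : E -> nat) : E := inj (mkD b F).

Lemma mk_bnd b k F : b < k -> tr k (mk b F) = mk b F.
Proof. by case: k => // k; exact: (@tr_inj k b). Qed.

Lemma ev_mk b F e : ev b (mk b F) e = F (tr b e).
Proof. by rewrite /ev /mk /inj cast_id; case: b. Qed.

Lemma ev_tr_arg b d e : ev b d (tr b e) = ev b d e.
Proof. by case: b => //= b; rewrite /ev /= /inj cast_id. Qed.

Lemma mk_eq b F G : (forall e, tr b e = e -> F e = G e) -> mk b F = mk b G.
Proof.
move=> FG; congr inj; case: b FG => [|b] FG /=; first exact/FG.
by apply/funext => c; apply: FG; exact: (tr_inj c (leqnn b)).
Qed.

Lemma mk_ev b d : tr b.+1 d = d -> mk b (ev b d) = d.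
Proof.
move=> {2}<-; congr inj; rewrite /ev; case: b => //= b.
by apply/funext => c; rewrite /inj cast_id.
Qed.

Lemma mk_add b F G : mk b (fun e => F e + G e) = mk b F ⊕ mk b G.
Proof.
apply/functional_extensionality_dep => n.
by rewrite /mk /inj /eadd -cast_add; congr cast; case: b.
Qed.

Lemma mk_cst b k : mk b (fun=> k) = ecst k.
Proof.
apply/functional_extensionality_dep => n.
by rewrite /mk /inj /ecst -(cast_cst b); congr cast; case: b.
Qed.

Lemma ev_add b d d' e : ev b (d ⊕ d') e = ev b d e + ev b d' e.
Proof. by case: b. Qed.

Lemma ev_cst b k e : ev b (ecst k) e = k.
Proof. by case: b. Qed.

(** Raising the rank precomposes with a cast of the argument, which the coherence of the levels of
    [e] undoes. *)
Lemma ev_wide b b' l d e : tr b.+1 d = d -> tr l e = e -> b <= b' ->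
  ev b' d e = ev b d e.
Proof.
move=> dP eP bb'; rewrite /ev (levelE_up b' dP (leqnn b)).
case: b b' bb' {dP} => [|b] [|b'] //= bb'.
by rewrite castSS -(levelE eP (bb' : b <= b')).
Qed.

Lemma tr_mk b b' F : b' <= b -> tr b'.+1 (mk b F) = mk b' F.
Proof.
move=> bb'; rewrite /= /mk /inj; apply/functional_extensionality_dep => n.
congr cast; case: b' b bb' => [|b'] [|b] //= bb'.
  by change (F (inj (dcst b 0)) = F (ecst 0)); rewrite inj_cst0.
rewrite castSS; apply/funext => c; congr F; apply/functional_extensionality_dep => k.
by apply: cast_cast; rewrite geq_min (bb' : b' <= b).
Qed.

Lemma ev_tr k q q' d e : tr k d = d -> tr q' e = e -> q' <= q ->
  ev q' (tr q'.+1 d) e = ev q d e.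
Proof.
move=> dP eP qq'; rewrite /ev /= /inj cast_id.
case: q' q eP qq' => [|q'] [|q] // eP qq' /=; rewrite (levelE dP qq').
  by rewrite -eP.
by rewrite castSS /= -(levelE_up _ eP).
Qed.

(** * The order on values *)

Definition le k (d d' : E) : Prop :=
  [/\ tr k d = d, tr k d' = d' & forall n, leD (d n) (d' n)].

Lemma le_refl_l k d d' : le k d d' -> le k d d.
Proof. by case=> dP _ H; split=> // n; have [] := leD_refl (H n). Qed.

Lemma le_refl_r k d d' : le k d d' -> le k d' d'.
Proof. by case=> _ dP H; split=> // n; have [] := leD_refl (H n). Qed.

Lemma le_trans k d e f : le k d e -> le k e f -> le k d f.
Proof. by case=> dP _ H [_ fP H']; split=> // n; apply: leD_trans (H n) (H' n). Qed.

Lemma le_weaken k l d d' : k <= l -> le k d d' -> le l d d'.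
Proof. by move=> kl [dP dP' H]; split=> //; apply: tr_weaken kl _. Qed.

Lemma le_add k d d' e e' : le k d d' -> le k e e' -> le k (d ⊕ e) (d' ⊕ e').
Proof.
move=> [dP dP' H] [eP eP' H']; split; rewrite ?tr_add; first by congr eadd.
  by congr eadd.
by move=> n; apply: leD_add.
Qed.

Lemma le_cst k m n : m <= n -> le k.+1 (ecst m) (ecst n).
Proof. by move=> mn; split; rewrite ?tr_cst // => l; exact: leD_cst. Qed.

Lemma le0 k d : le k d d -> le k (ecst 0) d.
Proof. by case=> dP _ H; split=> //; [exact: tr0|move=> n; exact: leD0]. Qed.

Lemma le00 k : le k (ecst 0) (ecst 0).
Proof. by split; rewrite ?tr0 // => n; exact: leD_cst. Qed.

Lemma le_tr k l d d' : le l d d' -> le k (tr k d) (tr k d').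
Proof.
move=> [_ _ H]; split; rewrite ?trK //; case: k => [|k] n; first exact: leD_cst.
exact: leD_cast.
Qed.

Lemma le_tr_id k l d : le l d d -> le l (tr k d) d.
Proof.
move=> [dP _ H]; split=> //.
  have [kl|lk] := leqP k l; first exact: tr_trW.
  by rewrite (tr_weaken (ltnW lk) dP).
move=> n; case: k => [|k] /=; first exact: leD0.
have [kn|nk] := leqP k n; first by rewrite (levelE dP kn); exact: leD_castK.
by rewrite /inj -(levelE dP (ltnW nk)).
Qed.

Lemma le_level0 k d d' : le k d d' -> d 0 <= d' 0.
Proof. by case=> _ _ /(_ 0). Qed.

Lemma ev_le b k l d d' e e' : le k d d' -> le l e e' -> ev b d e <= ev b d' e'.
Proof.
case: b => [|b] [_ _ H] [_ _ H']; first exact: (H 0).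
have [? _ _ H1] := H b.+1 _ _ (H' b); exact: leq_trans H1.
Qed.

Definition mono b (F : E -> nat) : Prop := forall e e', le b e e' -> F e <= F e'.

Lemma mk_le b F G : mono b F -> mono b G ->
  (forall e, le b e e -> F e <= G e) -> le b.+1 (mk b F) (mk b G).
Proof.
move=> mF mG FG; split; [exact: mk_bnd|exact: mk_bnd|move=> n; apply: leD_cast].
case: b mF mG FG => [|b] mF mG FG /=; first exact/FG/le00.
move=> c c' cc'.
have H : le b.+1 (inj c) (inj c').
  by split; [exact: (tr_inj c (leqnn b))|exact: (tr_inj c' (leqnn b))|move=> m; exact: leD_cast].
by split; [exact: mF|exact: mG|exact/FG/(le_refl_l H)|exact/FG/(le_refl_r H)].
Qed.

Arguments tr : simpl never.

(** * Application, abstraction and expansion of values *)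

Fixpoint rank (A : ty) : nat :=
  match A with
  | Tau => 0
  | Arr A B => maxn (rank A).+1 (rank B)
  | Conj A B => maxn (rank A) (rank B)
  end.

(** The length of [nf A]. An abstraction of result type [B] adds [width B] rather than 1 to its
    value because it may distribute over a product. *)
Fixpoint width (A : ty) : nat :=
  match A with
  | Tau => 1
  | Arr _ B => width B
  | Conj A B => width A + width B
  end.

Lemma rank_equiv A B : A ≡ B -> rank A = rank B.
Proof. by elim=> //= *; lia. Qed.

Lemma width_equiv A B : A ≡ B -> width A = width B.
Proof. by elim=> //= *; lia. Qed.

Lemma width_gt0 A : 0 < width A.
Proof. by elim: A => //= *; lia. Qed.

Lemma tr_level0 b k e : tr b e = e -> 0 < k -> tr k e 0 = e 0.
Proof. by case: k => // k eP _; rewrite (levelE eP (leq0n k)). Qed.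

Lemma ev_tr_wide b k l d e : tr l e = e -> b <= k -> ev b d (tr k e) = ev b d e.
Proof. by move=> eP bk; rewrite -ev_tr_arg (tr_tr eP bk) ev_tr_arg. Qed.

Lemma mk_wide q q' F : q <= q' -> mk q F = mk q' (fun e => F (tr q e)).
Proof.
move=> qq'; rewrite -[LHS](@mk_ev q') ?mk_bnd //; apply: mk_eq => e eP.
by rewrite (ev_wide _ eP qq') ?ev_mk ?mk_bnd.
Qed.

(* Application of a value of rank at most [q] with result of rank [b]; the
   summand [s 0] makes it strictly monotone in [s] even if the function ignores
   its argument. *)
Definition app q b (d s : E) : E := mk b (fun c => ev q d (s ⊕ c) + s 0).

Lemma app_bnd q b d s : tr b.+1 (app q b d s) = app q b d s.
Proof. exact: mk_bnd. Qed.

Lemma app_le q b d d' s s' : b <= q -> le q.+1 d d' -> le q s s' ->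
  le b.+1 (app q b d s) (app q b d' s').
Proof.
move=> bq dd' ss'.
have H d0 s0 : le q.+1 d0 d0 -> le q s0 s0 -> mono b (fun c => ev q d0 (s0 ⊕ c) + s0 0).
  move=> dd ss e e' ee'; rewrite leq_add2r; apply: ev_le dd _.
  exact: le_add ss (le_weaken bq ee').
apply: mk_le => [||e ee].
- by apply: H; [exact: le_refl_l dd'|exact: le_refl_l ss'].
- by apply: H; [exact: le_refl_r dd'|exact: le_refl_r ss'].
by apply: leq_add; [apply: ev_le dd' (le_add ss' (le_weaken bq ee))|exact: le_level0 ss'].
Qed.

(** Currying on values. It is an equality because arguments are only ever summed, and the summands
    [s 0] and [t 0] add up to that of [s ⊕ t]. *)
Lemma app_app q q1 b d s t : tr q1 t = t -> b <= q1 ->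
  app q1 b (app q q1 d s) t = app q b d (s ⊕ t).
Proof.
move=> tP bq1; apply: mk_eq => e eP.
rewrite /app ev_mk tr_add tP (tr_weaken bq1 eP) eaddA -addnA.
by congr (_ + _).
Qed.

Lemma tr_app q q' b b' k d s : b' <= b -> q' <= q -> b' <= q' ->
  tr k d = d -> tr q' s = s ->
  tr b'.+1 (app q b d s) = app q' b' (tr q'.+1 d) s.
Proof.
move=> bb' qq' bq' dP sP; rewrite /app tr_mk //; apply: mk_eq => e eP.
by rewrite (ev_tr dP _ qq') // tr_add sP (tr_weaken bq' eP).
Qed.

(** Zeta moves an argument from a product to its components, whose ranks may be smaller. The
    application at the smaller ranks is a truncation of the other one, and truncation decreases
    monotone values. *)
Lemma app_widen q q' b b' d s : b' <= b -> q' <= q -> b <= q -> b' <= q' ->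
  le q'.+1 d d -> le q' s s -> le b.+1 (app q' b' d s) (app q b d s).
Proof.
move=> bb' qq' bq bq' dd ss; have [dP _ _] := dd; have [sP _ _] := ss.
rewrite -{1}dP -(tr_app bb' qq' bq' dP sP); apply: le_tr_id; apply: app_le => //.
  exact: le_weaken dd.
exact: le_weaken ss.
Qed.

Lemma app_addl q b d d' s :
  app q b (d ⊕ d') s ⊕ ecst (s 0) = app q b d s ⊕ app q b d' s.
Proof.
rewrite /app -(mk_cst b) -!mk_add; apply: mk_eq => e _.
by rewrite ev_add; lia.
Qed.

Lemma app_cstl q b d k s : app q b (d ⊕ ecst k) s = app q b d s ⊕ ecst k.
Proof.
by rewrite /app -[X in _ = _ ⊕ X](mk_cst b) -mk_add; apply: mk_eq => e _; rewrite ev_add ev_cst addnAC.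
Qed.

Lemma app_cstr q b d s k : 0 < q -> b <= q -> le q.+1 d d -> le q s s ->
  le b.+1 (app q b d s ⊕ ecst k) (app q b d (s ⊕ ecst k)).
Proof.
case: q => // q _ bq dd ss.
have -> : app q.+1 b d (s ⊕ ecst k) = mk b (fun c => ev q.+1 d (s ⊕ ecst k ⊕ c) + s 0) ⊕ ecst k.
  by rewrite -[X in _ = _ ⊕ X](mk_cst b) -mk_add; apply: mk_eq => e _; rewrite -addnA.
have kk := le_cst q (leqnn k).
have H s0 m : le q.+1 s0 s0 -> mono b (fun c => ev q.+1 d (s0 ⊕ c) + m).
  move=> ss0 e e' ee'; rewrite leq_add2r; apply: ev_le dd _.
  exact: le_add ss0 (le_weaken bq ee').
apply: le_add; last exact: le_cst.
apply: mk_le => [||e ee]; [exact: H|by apply: H; apply: le_add|].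
rewrite leq_add2r; apply: ev_le dd (le_add _ (le_weaken bq ee)).
rewrite -{1}(eadd0 s); apply: le_add => //; exact: le_cst.
Qed.

(* Abstraction: an argument tuple [e] for the result supplies both the bound
   variable and the remaining arguments. *)
Definition lm q a b m n (F : E -> E) : E :=
  mk q (fun e => ev b (F (tr a.+1 e)) e + (m + n * e 0)).

Definition monoE a b (F : E -> E) : Prop :=
  forall x x', le a.+1 x x' -> le b.+1 (F x) (F x').

Lemma lm_le q a b m n m' n' F F' : a < q -> b <= q -> m <= m' -> n <= n' ->
  monoE a b F -> monoE a b F' -> (forall x, le a.+1 x x -> le b.+1 (F x) (F' x)) ->
  le q.+1 (lm q a b m n F) (lm q a b m' n' F').
Proof.
move=> aq bq mm nn mF mF' FF'.
have H G k l : monoE a b G -> mono q (fun e => ev b (G (tr a.+1 e)) e + (k + l * e 0)).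
  move=> mG e e' ee'; apply: leq_add; last first.
    by rewrite leq_add2l leq_mul2l (le_level0 ee') orbT.
  exact: ev_le (mG _ _ (le_tr a.+1 ee')) ee'.
apply: mk_le => [||e ee]; [exact: H|exact: H|].
apply: leq_add; last by rewrite leq_add // leq_mul2r nn orbT.
exact: ev_le (FF' _ (le_tr a.+1 ee)) ee.
Qed.

Lemma lm_cst q a b m n F k :
  lm q a b m n (fun x => F x ⊕ ecst k) = lm q a b m n F ⊕ ecst k.
Proof.
rewrite /lm -[X in _ = _ ⊕ X](mk_cst q) -mk_add; apply: mk_eq => e _.
by rewrite ev_add ev_cst addnAC.
Qed.

(** Beta on values. Only an inequality holds, since the bound variable receives the sum of its own
    argument and the remaining ones; monotonicity makes this an upper bound. *)
Lemma app_lm_ge q a b m n F s : a < q -> b <= q -> monoE a b F -> le a.+1 s s ->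
  le b.+1 (F s ⊕ ecst (m + n * s 0)) (app q b (lm q a b m n F) s).
Proof.
move=> aq bq mF ss; have Fs := mF _ _ ss; have [FsP _ _] := Fs.
have sq : le q s s by exact: le_weaken ss.
rewrite -{1}(mk_ev FsP) -(mk_cst b) -mk_add; apply: mk_le => [e e' ee'|e e' ee'|e ee].
- by rewrite leq_add2r; apply: ev_le Fs ee'.
- rewrite leq_add2r; apply: ev_le (le_add sq (le_weaken bq ee')).
  by apply: (lm_le aq bq (leqnn _) (leqnn _) mF mF) => x; exact: mF.
have [sP _ _] := sq.
rewrite ev_mk tr_add sP; have [eP _ _] := le_weaken bq ee; rewrite eP.
rewrite -addnA; apply: leq_add.
  have se : le q s (s ⊕ e).
    by rewrite -{1}(eadd0 s); apply: le_add sq (le_weaken bq (le0 ee)).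
  have se' : le a.+1 s (tr a.+1 (s ⊕ e)) by have := le_tr a.+1 se; have [-> _ _] := ss.
  have := le_add (le0 sq) (le_weaken bq ee); rewrite (eaddC (ecst 0)) eadd0.
  exact: ev_le (mF _ _ se').
by change (m + n * s 0 <= m + n * (s 0 + e 0) + s 0); nia.
Qed.

(* Complete eta-delta expansion. Its bookkeeping summand depends on the widths
   so as to be invariant under the equivalence of types. *)
Fixpoint expand (A : ty) (d : E) : E :=
  match A with
  | Tau => d
  | Arr A B =>
    lm (rank (Arr A B)) (rank A) (rank B) (width A * width B) (width A * width B)
      (fun x => expand B (app (rank (Arr A B)) (rank B) d (expand A x)))
  | Conj A B => expand A (tr (rank A).+1 d) ⊕ expand B (tr (rank B).+1 d)
  end.

Lemma expand_bnd A d : tr (rank A).+1 d = d -> tr (rank A).+1 (expand A d) = expand A d.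
Proof.
elim: A d => [|A IHA B IHB|A IHA B IHB] d dP //; first exact: mk_bnd.
rewrite /= tr_add; congr eadd.
  by apply: (tr_weaken _ (IHA _ (trK _ _))) => /=; lia.
by apply: (tr_weaken _ (IHB _ (trK _ _))) => /=; lia.
Qed.

Lemma expand_equiv A B d : A ≡ B -> tr (rank A).+1 d = d -> expand A d = expand B d.
Proof.
move=> AB; elim: AB d => {A B}.
- by move=> A B d dP /=; rewrite eaddC.
- by move=> A B C d dP /=; rewrite eaddA !(tr_tr dP) //; lia.
- move=> A B C d dP /=; rewrite /lm.
  (* The two conjuncts may have different ranks; their abstractions are compared at the common
     rank. *)
  rewrite (@mk_wide (maxn (rank A).+1 (rank B)) (maxn (rank A).+1 (maxn (rank B) (rank C)))); last by lia.
  rewrite (@mk_wide (maxn (rank A).+1 (rank C)) (maxn (rank A).+1 (maxn (rank B) (rank C)))); last by lia.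
  rewrite -mk_add; apply: mk_eq => e eP.
  have R X : X = B \/ X = C ->
      ev (maxn (rank B) (rank C)) (expand X (tr (rank X).+1
        (app (maxn (rank A).+1 (maxn (rank B) (rank C))) (maxn (rank B) (rank C)) d
           (expand A (tr (rank A).+1 e))))) e =
      ev (rank X) (expand X (app (maxn (rank A).+1 (rank X)) (rank X)
        (tr (maxn (rank A).+1 (rank X)).+1 d)
        (expand A (tr (rank A).+1 (tr (maxn (rank A).+1 (rank X)) e)))))
        (tr (maxn (rank A).+1 (rank X)) e).
    move=> XP; have Xr : rank X <= maxn (rank B) (rank C) by case: XP => ->; lia.
    rewrite (ev_wide (expand_bnd (trK _ _)) eP Xr) (ev_tr_wide _ eP); last by lia.
    rewrite (tr_tr eP); last by lia.
    rewrite (@tr_app _ (maxn (rank A).+1 (rank X)) _ _ _ _ _ Xr _ _ dP) //; try lia.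
    by apply: (tr_weaken _ (expand_bnd (trK _ _))); lia.
  rewrite ev_add !R; [|by right|by left].
  by rewrite !(tr_level0 eP) //; try lia; nia.
- move=> A B C d dP; rewrite /= /lm.
  set q1 := maxn (rank B).+1 (rank C).
  have -> : maxn (maxn (rank A) (rank B)).+1 (rank C) = maxn (rank A).+1 q1 by lia.
  apply: mk_eq => e eP; rewrite ev_mk !(tr_tr eP) ?(tr_level0 eP) //; try lia.
  rewrite app_app; first last.
  - by lia.
  - by apply: (tr_weaken _ (expand_bnd (trK _ _))); lia.
  (* The summands agree since [(width A + width B) * width C] is the sum of the two contributions,
     and both abstractions read the same [e 0]. *)
  by rewrite (ev_tr_wide _ eP); [nia|lia].
- by [].
- by move=> A B AB IH d dP; rewrite IH // (rank_equiv AB).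
- by move=> A B C AB IHAB BC IHBC d dP; rewrite IHAB // IHBC // -(rank_equiv AB).
- move=> A A' B B' AA' IHA BB' IHB d dP.
  rewrite /= -(rank_equiv AA') -(rank_equiv BB') -(width_equiv AA') -(width_equiv BB').
  apply: mk_eq => e eP; rewrite -IHA; last exact: trK.
  by rewrite -IHB; last exact: app_bnd.
- move=> A A' B B' AA' IHA BB' IHB d dP.
  by rewrite /= -(rank_equiv AA') -(rank_equiv BB') IHA ?IHB // trK.
Qed.

Lemma monoE_expand_app A B q d d' :
  (forall x x', le (rank A).+1 x x' -> le (rank A).+1 (expand A x) (expand A x')) ->
  (forall x x', le (rank B).+1 x x' -> le (rank B).+1 (expand B x) (expand B x')) ->
  rank A < q -> rank B <= q -> le q.+1 d d' ->
  forall x x', le (rank A).+1 x x' ->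
  le (rank B).+1 (expand B (app q (rank B) d (expand A x))) (expand B (app q (rank B) d' (expand A x'))).
Proof.
move=> mA mB aq bq dd' x x' xx'; apply/mB/app_le => //.
by apply: le_weaken (mA _ _ xx').
Qed.

Lemma expand_le A d d' : le (rank A).+1 d d' -> le (rank A).+1 (expand A d) (expand A d').
Proof.
elim: A d d' => [|A IHA B IHB|A IHA B IHB] d d' dd' //=.
  have aq : rank A < maxn (rank A).+1 (rank B) by lia.
  have bq : rank B <= maxn (rank A).+1 (rank B) by lia.
  have M f f' := @monoE_expand_app A B _ f f' IHA IHB aq bq.
  apply: lm_le => //; [exact/M/(le_refl_l dd')|exact/M/(le_refl_r dd')|].
  by move=> x xx; apply: M.
apply: le_add.
  by apply: le_weaken (IHA _ _ (le_tr _ dd')); lia.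
by apply: le_weaken (IHB _ _ (le_tr _ dd')); lia.
Qed.

Lemma le_addr k d e : le k d d -> le k e e -> le k d (d ⊕ e).
Proof. by move=> dd ee; rewrite -{1}(eadd0 d); apply: le_add dd (le0 ee). Qed.

Lemma le_addl k d e : le k d d -> le k e e -> le k d (e ⊕ d).
Proof. by rewrite eaddC; exact: le_addr. Qed.

Lemma monoE_expand A B d : le (rank (Arr A B)).+1 d d ->
  monoE (rank A) (rank B)
    (fun x => expand B (app (rank (Arr A B)) (rank B) d (expand A x))).
Proof.
move=> dd x x' xx'; apply: monoE_expand_app xx' => //= *; rewrite ?leq_max ?leqnn ?orbT //;
  exact: expand_le.
Qed.

Lemma expand_ge A d : le (rank A).+1 d d -> le (rank A).+1 d (expand A d).
Proof.
elim: A d => [|A IHA B IHB|A IHA B IHB] d dd //.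
  set q := rank (Arr A B); have aq : rank A < q by rewrite /q /=; lia.
  have bq : rank B <= q by rewrite /q /=; lia.
  have [dP _ _] := dd; have mF := monoE_expand dd.
  rewrite -{1}(mk_ev dP); apply: mk_le => [e e' ee'|e e' ee'|e ee].
  - exact: ev_le dd ee'.
  - apply: leq_add; first exact: ev_le (mF _ _ (le_tr _ ee')) ee'.
    by rewrite leq_add2l leq_mul2l (le_level0 ee') orbT.
  have ae := le_tr (rank A).+1 ee.
  apply: leq_trans (leq_addr _ _).
  have H : le (rank B).+1 (app q (rank B) d (tr (rank A).+1 e))
      (expand B (app q (rank B) d (expand A (tr (rank A).+1 e)))).
    apply: le_trans (IHB _ _) _; first by apply: app_le => //; apply: le_weaken ae.
    apply: expand_le; apply: app_le => //; apply: le_weaken (IHA _ ae) => //.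
  apply: leq_trans (ev_le _ H ee); rewrite ev_mk; apply: leq_trans (leq_addr _ _).
  have [eP _ _] := ee; have be := le_tr (rank B) ee.
  rewrite -(ev_tr_arg q d e).
  (* [d] reads [e] only below level [q]. That part of [e] is either the bound argument or the
     remaining arguments, so it lies below their sum. *)
  have [E|E] : q = (rank A).+1 \/ q = rank B by rewrite /q /=; lia.
    apply: ev_le dd _; rewrite E; apply: (le_addr ae).
    by apply: le_weaken be; rewrite -E.
  apply: ev_le dd _; rewrite E; apply: (le_addl be).
  by apply: le_weaken ae; rewrite -E.
have [dP _ _] := dd; have ad := le_tr (rank A).+1 dd; have bd := le_tr (rank B).+1 dd.
have aM : (rank A).+1 <= (rank (Conj A B)).+1 by rewrite /=; lia.
have bM : (rank B).+1 <= (rank (Conj A B)).+1 by rewrite /=; lia.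
apply: (@le_trans _ _ (tr (rank A).+1 d ⊕ tr (rank B).+1 d)); last first.
  by apply: le_add; [apply: le_weaken (IHA _ ad)|apply: le_weaken (IHB _ bd)].
(* One of the two truncations is [d] itself. *)
have [E|E] : rank (Conj A B) = rank A \/ rank (Conj A B) = rank B by rewrite /=; lia.
  rewrite -{1}dP {2}E; apply: le_addr; last exact: le_weaken bd.
  exact: le_weaken ad.
rewrite -{1}dP {2}E; apply: le_addl; last exact: le_weaken ad.
exact: le_weaken bd.
Qed.

Lemma expand_add_cst A d k : le (rank A).+1 d d ->
  le (rank A).+1 (expand A d ⊕ ecst k) (expand A (d ⊕ ecst k)).
Proof.
elim: A d => [|A IHA B IHB|A IHA B IHB] d dd.
- by apply: le_add dd _; exact: le_cst.
- set q := rank (Arr A B); have aq : rank A < q by rewrite /q /=; lia.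
  have bq : rank B <= q by rewrite /q /=; lia.
  have kk := le_cst q (leqnn k); have dk := le_add dd kk.
  have mF := monoE_expand dd; have mF' := monoE_expand dk.
  have -> : expand (Arr A B) d ⊕ ecst k =
      lm q (rank A) (rank B) (width A * width B) (width A * width B)
        (fun x => expand B (app q (rank B) d (expand A x)) ⊕ ecst k).
    by rewrite lm_cst.
  apply: lm_le => // [x x' xx'|x xx]; first by apply: le_add (mF _ _ xx') (le_cst _ (leqnn k)).
  rewrite app_cstl; apply: IHB; apply: app_le => //.
  exact: le_weaken (expand_le xx).
rewrite /= !tr_add !tr_cst.
have ad := le_tr (rank A).+1 dd; have bd := le_tr (rank B).+1 dd.
(* Each conjunct carries its own copy of the constant, and [k <= k + k]. *)
apply: (@le_trans _ _ ((expand A (tr (rank A).+1 d) ⊕ ecst k) ⊕ (expand B (tr (rank B).+1 d) ⊕ ecst k))).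
  rewrite eaddACA; apply: le_add.
    apply: le_add.
      by apply: le_weaken (expand_le ad); lia.
    by apply: le_weaken (expand_le bd); lia.
  by rewrite eadd_cst; apply: le_cst; lia.
apply: le_add.
  by apply: le_weaken (IHA _ ad); lia.
by apply: le_weaken (IHB _ bd); lia.
Qed.

(** * Values of terms *)

(** The power turns the sum over curried arguments into a product, and multiplication distributes
    over the conjuncts of the result: hence the invariance under equivalence. *)
Fixpoint vol (A : ty) : nat :=
  match A with
  | Tau => 1
  | Arr A B => 2 ^ vol A * vol B
  | Conj A B => vol A + vol B
  end.

Lemma vol_equiv A B : A ≡ B -> vol A = vol B.
Proof.
elim=> //= {A B}.
- by move=> *; lia.
- by move=> *; lia.
- by move=> *; lia.
- by move=> A B C; rewrite expnD mulnA.
- by move=> A B C _ -> _ ->.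
- by move=> A A' B B' _ -> _ ->.
- by move=> A A' B B' _ -> _ ->.
Qed.

Lemma vol_gt0 A : 0 < vol A.
Proof. by elim: A => //= [A _ B IH|A IHA B IHB]; rewrite ?muln_gt0 ?expn_gt0 //; lia. Qed.

Definition height (A : ty) : nat := 4 ^ vol A.

Lemma height_equiv A B : A ≡ B -> height A = height B.
Proof. by move=> /vol_equiv; rewrite /height => ->. Qed.

Lemma height_arr A B : height A <= height (Arr A B) /\ height B <= height (Arr A B).
Proof.
have [vA vB] := (vol_gt0 A, vol_gt0 B); rewrite /height !leq_exp2l //=.
by have := ltn_expl (vol A) (isT : 1 < 2); split; nia.
Qed.

Lemma height_conj A B : height A < height (Conj A B) /\ height B < height (Conj A B).
Proof.
by have [vA vB] := (vol_gt0 A, vol_gt0 B); rewrite /height !ltn_exp2l //=; lia.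
Qed.

(* Room for one zeta step in head position: a head of type [A ⇒ C ∧ D] turns
   into a head of type [C ∧ D] with components applied to an argument. *)
Lemma height_zeta A C D :
  height (Conj C D) + maxn (height (Arr A C)) (height (Arr A D)) + 2 <=
  height (Arr A (Conj C D)).
Proof.
have [vA [vC vD]] := (vol_gt0 A, (vol_gt0 C, vol_gt0 D)); rewrite /height /=.
set a := 2 ^ vol A; have a2 : 2 <= a by rewrite -{1}(expn1 2) leq_exp2l.
(* The three exponents on the left are at most [t], while [4 ^ t.+2] is sixteen times [4 ^ t]. *)
have [t Et] : exists t, a * (vol C + vol D) = t.+2.
  by exists (a * (vol C + vol D) - 2); nia.
have H x : x <= t -> 4 ^ x <= 4 ^ t by move=> ?; rewrite leq_exp2l.
have H1 : 4 ^ (vol C + vol D) <= 4 ^ t by apply: H; nia.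
have H2 : 4 ^ (a * vol C) <= 4 ^ t by apply: H; nia.
have H3 : 4 ^ (a * vol D) <= 4 ^ t by apply: H; nia.
have H4 : 0 < 4 ^ t by rewrite expn_gt0.
by rewrite Et !expnS; lia.
Qed.

Definition expands k A (d : E) : E := iter k (expand A) d.

Lemma expands_bnd k A d : tr (rank A).+1 d = d ->
  tr (rank A).+1 (expands k A d) = expands k A d.
Proof. by move=> dP; elim: k => //= k IH; exact: expand_bnd. Qed.

Lemma expands_equiv k A B d : A ≡ B -> tr (rank A).+1 d = d ->
  expands k A d = expands k B d.
Proof.
move=> AB dP; elim: k => //= k <-; apply: expand_equiv => //.
exact: expands_bnd.
Qed.

Lemma expands_le k A d d' : le (rank A).+1 d d' ->
  le (rank A).+1 (expands k A d) (expands k A d').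
Proof. by move=> dd'; elim: k => //= k IH; exact: expand_le. Qed.

Lemma expands_leq k l A d : k <= l -> le (rank A).+1 d d ->
  le (rank A).+1 (expands k A d) (expands l A d).
Proof.
move=> /subnKC <- dd; rewrite addnC /expands iterD.
elim: (l - k) => [|m IH] /=; first exact: expands_le.
by apply: (le_trans IH); apply: expand_ge; exact: le_refl_r IH.
Qed.

Lemma expands_ge k A d : le (rank A).+1 d d -> le (rank A).+1 d (expands k A d).
Proof. exact: (@expands_leq 0). Qed.

Lemma expands_add_cst k A d m : le (rank A).+1 d d ->
  le (rank A).+1 (expands k A d ⊕ ecst m) (expands k A (d ⊕ ecst m)).
Proof.
move=> dd; elim: k => /= [|k IH]; first by apply: le_add dd (le_cst _ (leqnn m)).
apply: le_trans (expand_le IH).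
by apply: expand_add_cst; exact: expands_le.
Qed.

(** Truncating [d ⊕ e] to the rank of one conjunct leaves at least the component of that conjunct,
    so expanding the sum expands both components. *)
Lemma expands_conj k A B d e : le (rank A).+1 d d -> le (rank B).+1 e e ->
  le (rank (Conj A B)).+1 (expands k A d ⊕ expands k B e)
    (expands k (Conj A B) (d ⊕ e)).
Proof.
move=> dd ee; have aM : rank A < (rank (Conj A B)).+1 by rewrite /=; lia.
have bM : rank B < (rank (Conj A B)).+1 by rewrite /=; lia.
elim: k => /= [|k IH]; first by apply: le_add; [exact: le_weaken dd|exact: le_weaken ee].
have dk := expands_le k dd; have ek := expands_le k ee.
have dkw := le_weaken aM dk; have ekw := le_weaken bM ek.
apply: le_add.
  apply: le_weaken aM _; apply: expand_le.
  have := le_tr (rank A).+1 (le_trans (le_addr dkw ekw) IH).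
  by have [-> _ _] := dk.
apply: le_weaken bM _; apply: expand_le.
have := le_tr (rank B).+1 (le_trans (le_addl ekw dkw) IH).
by have [-> _ _] := ek.
Qed.

Lemma rank_arr A B : rank A < rank (Arr A B) /\ rank B <= rank (Arr A B).
Proof. by rewrite /=; lia. Qed.

Lemma app_expand A B d s : le (rank (Arr A B)).+1 d d -> le (rank A).+1 s s ->
  le (rank B).+1
    (expand B (app (rank (Arr A B)) (rank B) d (expand A s)) ⊕
      ecst (width A * width B + width A * width B * s 0))
    (app (rank (Arr A B)) (rank B) (expand (Arr A B) d) s).
Proof.
move=> dd ss; have [aq bq] := rank_arr A B.
exact: (app_lm_ge (F := fun x => expand B (app _ _ d (expand A x))) _ _ aq bq (monoE_expand dd) ss).
Qed.

(** Each expansion of a function is worth one of its argument and one of its result. In this way the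
    expansions stored in a head value become available to what beta and zeta leave behind. *)
Lemma app_expands k A B d s : le (rank (Arr A B)).+1 d d -> le (rank A).+1 s s ->
  le (rank B).+1
    (expands k B (app (rank (Arr A B)) (rank B) d (expands k A s)))
    (app (rank (Arr A B)) (rank B) (expands k (Arr A B) d) s).
Proof.
have [aq bq] := rank_arr A B.
elim: k s => [|k IH] s dd ss; first by apply: app_le => //; exact: le_weaken ss.
have es := expand_le ss; have dk := expands_le k dd.
rewrite {2}/expands iterSr -/(expands _ _ _).
apply: le_trans (expand_le (IH _ dd es)) _.
apply: le_trans (app_expand dk ss).
apply: le_addr; last exact: le_cst.
by apply: expand_le; apply: app_le => //; exact: le_weaken es.
Qed.

Definition neutral (r : preterm) : bool := is_elim r || is_var r.

(* A redex may be contracted wherever it occurs, but an elimination or a variable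
   expands only outside head position. Its value there is the expanded one. An
   introduction in head position may break up, by zeta, pi and beta, into parts
   that can be expanded afterwards: its value there is expanded often enough. *)
Definition arg_val (r : preterm) (d : E) : E :=
  if neutral r then expand (type_of r) d else d.
Definition head_val (r : preterm) (d : E) : E :=
  if neutral r then d else expands (height (type_of r)) (type_of r) d.

Definition env : Type := tyclass -> nat -> E.

Definition extend (U : tyclass) (x : E) (rho : env) : env :=
  fun T n => if T == U then (if n is m.+1 then rho T m else x) else rho T n.

Fixpoint sem (r : preterm) (rho : env) : E :=
  match r with
  | Var U n => rho U n
  | Lam U r =>
    lm (rank (Arr (repr U) (type_of r))) (rank (repr U)) (rank (type_of r))
      (width (type_of r)) 0 (fun x => arg_val r (sem r (extend U x rho)))
  | App r s =>
    app (rank (Arr (type_of s) (type_of (App r s)))) (rank (type_of (App r s)))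
      (head_val r (sem r rho)) (arg_val s (sem s rho))
  | Prod r s => arg_val r (sem r rho) ⊕ arg_val s (sem s rho)
  | Proj A r => tr (rank A).+1 (head_val r (sem r rho))
  end.

Definition arg_sem r rho := arg_val r (sem r rho).
Definition head_sem r rho := head_val r (sem r rho).

Definition env_le (rho rho' : env) : Prop :=
  forall A n, le (rank A).+1 (rho (cls A) n) (rho' (cls A) n).

Lemma type_of_equiv r A : r ∈ A -> type_of r ≡ A.
Proof. by move=> /type_ofE ->; exact: canon_equiv. Qed.

Lemma type_of_eq r s A : r ∈ A -> s ∈ A -> type_of r = type_of s.
Proof. by move=> /type_ofE -> /type_ofE ->. Qed.

Lemma rank_type_of r A : r ∈ A -> rank (type_of r) = rank A.
Proof. by move=> /type_of_equiv/rank_equiv. Qed.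

Lemma width_type_of r A : r ∈ A -> width (type_of r) = width A.
Proof. by move=> /type_of_equiv/width_equiv. Qed.

Lemma arg_valE r A d : r ∈ A -> tr (rank A).+1 d = d ->
  arg_val r d = if neutral r then expand A d else d.
Proof.
move=> rA dP; rewrite /arg_val; case: ifP => // _.
by apply: expand_equiv; [exact: type_of_equiv|rewrite (rank_type_of rA)].
Qed.

Lemma head_valE r A d : r ∈ A -> tr (rank A).+1 d = d ->
  head_val r d = if neutral r then d else expands (height A) A d.
Proof.
move=> rA dP; rewrite /head_val; case: ifP => // _.
rewrite (height_equiv (type_of_equiv rA)); apply: expands_equiv.
  exact: type_of_equiv.
by rewrite (rank_type_of rA).
Qed.

Lemma sem_lam A B r rho : r ∈ B ->
  sem (Lam (cls A) r) rho =
  lm (rank (Arr A B)) (rank A) (rank B) (width B) 0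
    (fun x => arg_sem r (extend (cls A) x rho)).
Proof.
move=> rB; rewrite /= (rank_type_of rB) (width_type_of rB).
by rewrite -/(canon A) (rank_equiv (canon_equiv A)).
Qed.

Lemma sem_prod r s rho : sem (r × s)%P rho = arg_sem r rho ⊕ arg_sem s rho.
Proof. by []. Qed.

Lemma sem_proj A r rho : sem (Proj A r) rho = tr (rank A).+1 (head_sem r rho).
Proof. by []. Qed.

Lemma sem_app A B r s rho : r ∈ Arr A B -> s ∈ A ->
  sem (r @ s)%P rho =
  app (rank (Arr A B)) (rank B) (head_sem r rho) (arg_sem s rho).
Proof.
move=> rAB sA /=.
by rewrite (rank_type_of sA) (rank_type_of (typing_app rAB sA)).
Qed.

Lemma arg_val_add_cst r s A d e k : r ∈ A -> s ∈ A -> neutral r = neutral s ->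
  le (rank A).+1 e e -> le (rank A).+1 (e ⊕ ecst k) d ->
  le (rank A).+1 (arg_val s e ⊕ ecst k) (arg_val r d).
Proof.
move=> rA sA rs ee ed; have [_ dP _] := ed; have [eP _ _] := ee.
rewrite (arg_valE rA dP) (arg_valE sA eP) rs; case: ifP => // _.
exact: le_trans (expand_add_cst _ ee) (expand_le ed).
Qed.

Lemma head_val_add_cst r s A d e k : r ∈ A -> s ∈ A -> neutral r = neutral s ->
  le (rank A).+1 e e -> le (rank A).+1 (e ⊕ ecst k) d ->
  le (rank A).+1 (head_val s e ⊕ ecst k) (head_val r d).
Proof.
move=> rA sA rs ee ed; have [_ dP _] := ed; have [eP _ _] := ee.
rewrite (head_valE rA dP) (head_valE sA eP) rs; case: ifP => // _.
exact: le_trans (expands_add_cst _ _ ee) (expands_le _ ed).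
Qed.

Lemma arg_val_le r s A d e : r ∈ A -> s ∈ A -> neutral r = neutral s ->
  le (rank A).+1 e d -> le (rank A).+1 (arg_val s e) (arg_val r d).
Proof.
move=> rA sA rs ed; have := arg_val_add_cst (k := 0) rA sA rs (le_refl_l ed).
by rewrite !eadd0; exact.
Qed.

Lemma head_val_le r s A d e : r ∈ A -> s ∈ A -> neutral r = neutral s ->
  le (rank A).+1 e d -> le (rank A).+1 (head_val s e) (head_val r d).
Proof.
move=> rA sA rs ed; have := head_val_add_cst (k := 0) rA sA rs (le_refl_l ed).
by rewrite !eadd0; exact.
Qed.

Lemma env_le_extend A x x' rho rho' : env_le rho rho' -> le (rank A).+1 x x' ->
  env_le (extend (cls A) x rho) (extend (cls A) x' rho').
Proof.
move=> H xx' B n; rewrite /extend; case: eqP => [/clsP BA|_]; last exact: H.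
by case: n => [|n]; [rewrite (rank_equiv BA)|exact: H].
Qed.

Lemma rank_conj A B : rank A <= rank (Conj A B) /\ rank B <= rank (Conj A B).
Proof. by rewrite /=; lia. Qed.

Lemma sem_le r A rho rho' : r ∈ A -> env_le rho rho' ->
  le (rank A).+1 (sem r rho) (sem r rho').
Proof.
move=> rA; elim: rA rho rho' => {r A}.
- by move=> A n rho rho' /(_ A n).
- by move=> r A B _ IH /rank_equiv <-.
- move=> A B r rB IH rho rho' H; rewrite !(sem_lam _ _ rB).
  have [aq bq] := rank_arr A B.
  have M rho1 rho2 : env_le rho1 rho2 -> forall x x', le (rank A).+1 x x' ->
      le (rank B).+1 (arg_sem r (extend (cls A) x rho1)) (arg_sem r (extend (cls A) x' rho2)).
    by move=> H' x x' xx'; apply: arg_val_le => //; apply: IH; exact: env_le_extend.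
  apply: lm_le => //.
  - by apply: M => C n; exact: le_refl_l (H C n).
  - by apply: M => C n; exact: le_refl_r (H C n).
  by move=> x xx; exact: M.
- move=> A B r s rAB IHr sA IHs rho rho' H; rewrite !(sem_app _ rAB sA).
  have [aq bq] := rank_arr A B.
  apply: app_le => //; first exact: head_val_le (IHr _ _ H).
  apply: le_weaken aq _; exact: arg_val_le (IHs _ _ H).
- move=> A B r s rA IHr sB IHs rho rho' H /=; have [aM bM] := rank_conj A B.
  apply: le_add.
    by apply: le_weaken (arg_val_le rA rA erefl (IHr _ _ H)).
  by apply: le_weaken (arg_val_le sB sB erefl (IHs _ _ H)).
move=> A B r rAB IH rho rho' H /=.
exact: le_tr (head_val_le rAB rAB erefl (IH _ _ H)).
Qed.

Lemma arg_sem_le r A rho rho' : r ∈ A -> env_le rho rho' ->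
  le (rank A).+1 (arg_sem r rho) (arg_sem r rho').
Proof. by move=> rA H; exact: arg_val_le (sem_le rA H). Qed.

Lemma head_sem_le r A rho rho' : r ∈ A -> env_le rho rho' ->
  le (rank A).+1 (head_sem r rho) (head_sem r rho').
Proof. by move=> rA H; exact: head_val_le (sem_le rA H). Qed.

Lemma neutral_rename f r : neutral (rename f r) = neutral r.
Proof. by case: r. Qed.

Lemma type_of_rename f r A : r ∈ A -> type_of (rename f r) = type_of r.
Proof. by move=> rA; exact: type_of_eq (typing_rename f rA) rA. Qed.

Lemma arg_val_rename f r A d : r ∈ A -> arg_val (rename f r) d = arg_val r d.
Proof. by move=> rA; rewrite /arg_val neutral_rename (type_of_rename _ rA). Qed.

Lemma head_val_rename f r A d : r ∈ A -> head_val (rename f r) d = head_val r d.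
Proof. by move=> rA; rewrite /head_val neutral_rename (type_of_rename _ rA). Qed.

Lemma sem_rename f r A rho : r ∈ A ->
  sem (rename f r) rho = sem r (fun U n => rho U (f U n)).
Proof.
move=> rA; elim: rA f rho => {r A} //.
- move=> A B r rB IH f rho /=; rewrite (type_of_rename _ rB); congr lm.
  apply/funext => x; rewrite (arg_val_rename _ _ rB) IH; congr (arg_val r (sem r _)).
  apply/funext => U; apply/funext => n; rewrite /extend /up_ren.
  by case: (U == cls A) => //; case: n.
- move=> A B r s rAB IHr sA IHs f rho.
  rewrite [rename _ _]/= (sem_app _ (typing_rename f rAB) (typing_rename f sA)) (sem_app _ rAB sA).
  by rewrite /head_sem /arg_sem IHr IHs (head_val_rename _ _ rAB) (arg_val_rename _ _ sA).
- move=> A B r s rA IHr sB IHs f rho /=.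
  by rewrite IHr IHs (arg_val_rename _ _ rA) (arg_val_rename _ _ sB).
- by move=> A B r rAB IH f rho /=; rewrite IH (head_val_rename _ _ rAB).
Qed.

Lemma sem_shift A x r B rho : r ∈ B ->
  sem (rename (shift (cls A)) r) (extend (cls A) x rho) = sem r rho.
Proof.
move=> rB; rewrite (sem_rename _ _ rB); congr sem.
apply/funext => U; apply/funext => n; rewrite /extend /shift.
by case: eqP => // _.
Qed.

(** A variable is worth [rho' x] in head position and the expansion of this in argument position.
    What replaces it may be an introduction, valued differently in the two positions, so both bounds
    are required. *)
Definition subst_le (sigma : tyclass -> nat -> preterm) (rho rho' : env) : Prop :=
  forall A n,
    le (rank A).+1 (head_sem (sigma (cls A) n) rho) (rho' (cls A) n) /\
    le (rank A).+1 (arg_sem (sigma (cls A) n) rho) (expand A (rho' (cls A) n)).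

Lemma subst_le_up A sigma x rho rho' : typing_subst_map sigma ->
  le (rank A).+1 x x -> subst_le sigma rho rho' ->
  subst_le (up_subst (cls A) sigma) (extend (cls A) x rho) (extend (cls A) x rho').
Proof.
move=> sP xx sl B n; have [h a] := sl B n.
rewrite /up_subst {2 4}/extend; case: eqP => [E|_]; last first.
  rewrite /head_sem /arg_sem !(sem_shift _ _ _ (sP B n)).
  by rewrite (head_val_rename _ _ (sP B n)) (arg_val_rename _ _ (sP B n)).
case: n h a => [|n] h a.
  have BA : B ≡ A by exact/clsP.
  have xx' : le (rank B).+1 x x by rewrite (rank_equiv BA).
  have [xP _ _] := xx'.
  rewrite /head_sem /arg_sem (head_valE (A := B)) ?(arg_valE (A := B)) /= /extend ?E ?eqxx //;
    try (by rewrite -E; exact: typing_var).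
  by split=> //; exact: expand_le.
have [h' a'] := sl B n.
rewrite /head_sem /arg_sem !(sem_shift _ _ _ (sP B n)).
by rewrite (head_val_rename _ _ (sP B n)) (arg_val_rename _ _ (sP B n)).
Qed.

Lemma sem_subst sigma r A rho rho' : typing_subst_map sigma -> env_le rho rho ->
  env_le rho' rho' -> subst_le sigma rho rho' -> r ∈ A ->
  le (rank A).+1 (head_sem (subst sigma r) rho) (head_sem r rho') /\
  le (rank A).+1 (arg_sem (subst sigma r) rho) (arg_sem r rho').
Proof.
move=> sP H H' sl rA; elim: rA sigma rho rho' sP H H' sl => {r A}.
- move=> A n sigma rho rho' sP H H' sl; have [h a] := sl A n; have [_ dP _] := h.
  rewrite /(head_sem (Var _ _)) /(arg_sem (Var _ _)).
  by rewrite (head_valE (typing_var A n) dP) (arg_valE (typing_var A n) dP).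
- by move=> r A B _ IH /rank_equiv <-.
- move=> A B r rB IH sigma rho rho' sP H H' sl.
  have rB' := typing_subst (typing_up_subst (cls A) sP) rB.
  have [aq bq] := rank_arr A B.
  (* Substitution keeps every outermost constructor other than a variable, hence the status of the
     term as neutral or introduction: comparing [sem] is enough. The same holds in the next
     cases. *)
  suff K : le (rank (Arr A B)).+1 (sem (Lam (cls A) (subst (up_subst (cls A) sigma) r)) rho)
      (sem (Lam (cls A) r) rho').
    by split; [apply: head_val_le K|apply: arg_val_le K] => //; exact: typing_lam.
  rewrite (sem_lam _ _ rB') (sem_lam _ _ rB); apply: lm_le => //.
  - move=> x x' xx'; apply: arg_sem_le => //; exact: env_le_extend.
  - move=> x x' xx'; apply: arg_sem_le => //; exact: env_le_extend.
  move=> x xx; apply: (IH _ _ _ _ _ _ _).2.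
  - exact: typing_up_subst.
  - exact: env_le_extend.
  - exact: env_le_extend.
  exact: subst_le_up.
- move=> A B r s rAB IHr sA IHs sigma rho rho' sP H H' sl.
  have [aq bq] := rank_arr A B.
  have rAB' := typing_subst sP rAB; have sA' := typing_subst sP sA.
  suff K : le (rank B).+1 (sem (subst sigma r @ subst sigma s)%P rho) (sem (r @ s)%P rho').
    by split; [apply: head_val_le K|apply: arg_val_le K] => //; exact: (typing_app (A := A)).
  rewrite (sem_app _ rAB' sA') (sem_app _ rAB sA); apply: app_le => //.
    exact: (IHr _ _ _ sP H H' sl).1.
  by apply: le_weaken (IHs _ _ _ sP H H' sl).2.
- move=> A B r s rA IHr sB IHs sigma rho rho' sP H H' sl.
  have [aM bM] := rank_conj A B.
  have rA' := typing_subst sP rA; have sB' := typing_subst sP sB.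
  suff K : le (rank (Conj A B)).+1 (sem (subst sigma r × subst sigma s)%P rho)
      (sem (r × s)%P rho').
    by split; [apply: head_val_le K|apply: arg_val_le K] => //; exact: typing_prod.
  apply: le_add; first by apply: le_weaken (IHr _ _ _ sP H H' sl).2.
  by apply: le_weaken (IHs _ _ _ sP H H' sl).2.
move=> A B r rAB IH sigma rho rho' sP H H' sl.
have rAB' := typing_subst sP rAB.
suff K : le (rank A).+1 (sem (Proj A (subst sigma r)) rho) (sem (Proj A r) rho').
  by split; [apply: head_val_le K|apply: arg_val_le K] => //;
    exact: (@typing_proj A B).
exact: le_tr (IH _ _ _ sP H H' sl).1.
Qed.

(** * Values along the five reduction rules *)

Lemma arg_sem_neutral r A rho : r ∈ A -> env_le rho rho -> neutral r ->
  arg_sem r rho = expand A (sem r rho).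
Proof.
move=> rA H nr; have [dP _ _] := sem_le rA H.
by rewrite /arg_sem (arg_valE rA dP) nr.
Qed.

Lemma head_sem_neutral r rho : neutral r -> head_sem r rho = sem r rho.
Proof. by rewrite /head_sem /head_val => ->. Qed.

Lemma arg_sem_intro r rho : ~~ neutral r -> arg_sem r rho = sem r rho.
Proof. by rewrite /arg_sem /arg_val => /negPf ->. Qed.

Lemma head_sem_intro r A rho : r ∈ A -> env_le rho rho -> ~~ neutral r ->
  head_sem r rho = expands (height A) A (sem r rho).
Proof.
move=> rA H nr; have [dP _ _] := sem_le rA H.
by rewrite /head_sem (head_valE rA dP) (negPf nr).
Qed.

(** A neutral term is worth more as an argument, an introduction more as a head; enough expansions
    of the argument value cover both. *)
Lemma head_sem_expands r A k rho : r ∈ A -> env_le rho rho -> height A <= k ->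
  le (rank A).+1 (head_sem r rho) (expands k A (arg_sem r rho)).
Proof.
move=> rA H hk; have sr := sem_le rA H; have ar := arg_sem_le rA H.
have [nr|nr] := boolP (neutral r).
  rewrite head_sem_neutral // (arg_sem_neutral rA H nr).
  apply: le_trans (expand_ge sr) _; exact: expands_ge (expand_le sr).
by rewrite (head_sem_intro rA H nr) arg_sem_intro //; exact: expands_leq.
Qed.

Lemma le_add_cst k d e m : le k.+1 d e -> le k.+1 (d ⊕ ecst m) (e ⊕ ecst m).
Proof. by move=> de; apply: le_add de (le_cst _ (leqnn m)). Qed.

Lemma subst_le_single A s x rho : s ∈ A -> env_le rho rho -> le (rank A).+1 x x ->
  le (rank A).+1 (head_sem s rho) x -> le (rank A).+1 (arg_sem s rho) x ->
  subst_le (single (cls A) s) rho (extend (cls A) x rho).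
Proof.
move=> sA H xx hx ax B n.
have V m : le (rank B).+1 (head_sem (Var (cls B) m) rho) (rho (cls B) m) /\
    le (rank B).+1 (arg_sem (Var (cls B) m) rho) (expand B (rho (cls B) m)).
  rewrite head_sem_neutral // (arg_sem_neutral (typing_var B m) H) //=.
  by split; [exact: H|exact: expand_le].
rewrite /single /extend; case: eqP => // /clsP/rank_equiv E; case: n => // {V}.
have xx' : le (rank B).+1 x x by rewrite E.
by rewrite E in hx ax *; split=> //; apply: le_trans ax _; rewrite -E; exact: expand_ge.
Qed.

Lemma beta_le A B r s rho : r ∈ B -> s ∈ A -> env_le rho rho ->
  let t := instantiate (cls A) s r in
  let d := sem (Lam (cls A) r @ s)%P rho in
  le (rank B).+1 (head_sem t rho ⊕ ecst 1) d /\
  le (rank B).+1 (arg_sem t rho ⊕ ecst 1) d.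
Proof.
move=> rB sA H t d; have [hA hB] := height_arr A B; have [aq bq] := rank_arr A B.
have lA := typing_lam A rB; have tB : t ∈ B := typing_subst (typing_single sA) rB.
set K := height (Arr A B) in hA hB.
(* All [K] expansions of the abstraction are passed on to the argument and to the result. As [K] is
   at least [height A] and [height B], [x] covers [s] wherever the variable occurs, and the result
   covers the contractum in head position. *)
have ss := arg_sem_le sA H; pose x := expands K A (arg_sem s rho).
have xx : le (rank A).+1 x x := expands_le K ss.
have Hx := env_le_extend H xx.
have tr : le (rank B).+1 (arg_sem t rho) (arg_sem r (extend (cls A) x rho)).
  have sl : subst_le (single (cls A) s) rho (extend (cls A) x rho).
    by apply: subst_le_single => //; [exact: head_sem_expands|exact: expands_ge].
  exact: (sem_subst (typing_single sA) H Hx sl rB).2.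
have rr := arg_sem_le rB Hx.
have D : le (rank B).+1 (expands K B (arg_sem t rho) ⊕ ecst 1) d.
  rewrite /d (sem_app _ lA sA) (head_sem_intro lA H) //.
  apply: le_trans (app_expands K (sem_le lA H) ss).
  have F : monoE (rank A) (rank B) (fun y => arg_sem r (extend (cls A) y rho)).
    by move=> y y' yy'; apply: arg_sem_le => //; exact: env_le_extend.
  have L := app_lm_ge (width B) 0 aq bq F xx; rewrite -(sem_lam _ _ rB) in L.
  apply: le_trans (expands_le K L).
  apply: le_trans (expands_add_cst K _ rr).
  apply: le_add; first exact: expands_le.
  by apply: le_cst; rewrite addn0 width_gt0.
split; apply: (le_trans _ D); apply: le_add_cst; first exact: head_sem_expands.
by apply: expands_ge; exact: le_refl_l tr.
Qed.

Lemma pi_le A B r s rho : r ∈ A -> s ∈ B -> env_le rho rho ->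
  let d := sem (Proj A (r × s)%P) rho in
  le (rank A).+1 (head_sem r rho) d /\ le (rank A).+1 (arg_sem r rho) d.
Proof.
move=> rA sB H d; have [hA hB] := height_conj A B; have [aM bM] := rank_conj A B.
set K := height (Conj A B) in hA hB.
have rr := arg_sem_le rA H; have ss := arg_sem_le sB H.
have D : le (rank A).+1 (expands K A (arg_sem r rho)) d.
  rewrite /d sem_proj (head_sem_intro (typing_prod rA sB) H) //=.
  have rK := expands_le K rr; have sK := expands_le K ss.
  have := le_tr (rank A).+1 (le_trans (le_addr _ _) (expands_conj K rr ss)).
  have [-> _ _] := rK; apply; first exact: le_weaken rK.
  exact: le_weaken sK.
split; apply: (le_trans _ D); last exact: expands_ge.
by apply: head_sem_expands => //; exact: ltnW.
Qed.

(** The expansions stored in [r × s] are spent in three portions: [k] let [r] and [s] become heads,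
    one pays for the copy of [t] and the strict decrease, and [k1.+1] go to the result. *)
Lemma zeta_le A C D r s t rho : r ∈ Arr A C -> s ∈ Arr A D -> t ∈ A ->
  env_le rho rho ->
  let u := ((r @ t) × (s @ t))%P in
  let d := sem ((r × s) @ t)%P rho in
  le (rank (Conj C D)).+1 (head_sem u rho ⊕ ecst 1) d /\
  le (rank (Conj C D)).+1 (arg_sem u rho ⊕ ecst 1) d.
Proof.
move=> rAC sAD tA H u d; pose CD := Conj C D; pose P := Arr A CD.
have [aq bq] := rank_arr A CD; rewrite -/P in aq bq.
have [aC cC] := rank_arr A C; have [aD dD] := rank_arr A D.
have PE : Conj (Arr A C) (Arr A D) ≡ P := tyequiv_sym (tyequiv_dist _ _ _).
have pP : (r × s)%P ∈ P := typing_equiv (typing_prod rAC sAD) PE.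
have rt := typing_app rAC tA; have st := typing_app sAD tA.
have uT : u ∈ CD := typing_prod rt st.
have tt := arg_sem_le tA H; have ttq : le (rank P) (arg_sem t rho) (arg_sem t rho).
  exact: le_weaken tt.
pose k := maxn (height (Arr A C)) (height (Arr A D)).
pose X := sem (r × s)%P rho; have XX : le (rank P).+1 X X := sem_le pP H.
pose Y := expands k P X; have YY : le (rank P).+1 Y Y := expands_le k XX.
have hr := head_sem_le rAC H; have hs := head_sem_le sAD H.
have rP : rank (Arr A C) < (rank P).+1 by rewrite /P /CD /=; lia.
have sP : rank (Arr A D) < (rank P).+1 by rewrite /P /CD /=; lia.
have hY : le (rank P).+1 (head_sem r rho ⊕ head_sem s rho) Y.
  have [XP _ _] := XX; rewrite /Y -(expands_equiv k PE); last by rewrite (rank_equiv PE).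
  rewrite -(rank_equiv PE); apply: le_trans (expands_conj k (arg_sem_le rAC H) (arg_sem_le sAD H)).
  have [rM sM] := rank_conj (Arr A C) (Arr A D).
  apply: le_add.
    apply: le_weaken (head_sem_expands rAC H _) => //; exact: leq_maxl.
  apply: le_weaken (head_sem_expands sAD H _) => //; exact: leq_maxr.
have [cM dM] := rank_conj C D; rewrite -/CD in cM dM.
have rs := sem_le rt H; have ss := sem_le st H.
pose w := arg_sem t rho 0.
(* The excess [w] appears because each of the two applications adds the level 0 value of [t], while
   the original one adds it once. *)
have Z : le (rank CD).+1 (sem (r @ t)%P rho ⊕ sem (s @ t)%P rho)
    (app (rank P) (rank CD) Y (arg_sem t rho) ⊕ ecst w).
  rewrite (sem_app _ rAC tA) (sem_app _ sAD tA).
  apply: le_trans (le_add_cst _ (app_le bq hY ttq)); rewrite app_addl.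
  by apply: le_add; apply: app_widen => //; exact: le_weaken tt.
pose V := sem (r @ t)%P rho ⊕ sem (s @ t)%P rho.
have VV : le (rank CD).+1 V V := le_refl_l Z.
(* One further expansion adds [width A * width CD] times [1 + w], which covers [w + 1]. *)
have YV : le (rank CD).+1 (V ⊕ ecst 1)
    (app (rank P) (rank CD) (expand P Y) (arg_sem t rho)).
  apply: le_trans (app_expand YY tt).
  apply: le_trans (le_add_cst 1 Z) _; rewrite -eaddA eadd_cst; apply: le_add.
    apply: le_trans (expand_ge (app_le bq YY ttq)) _.
    apply: expand_le; apply: app_le => //; exact: le_weaken (expand_ge tt).
  apply: le_cst; have := width_gt0 A; have := width_gt0 CD.
  by rewrite -/w; nia.
pose k1 := height CD.
(* In [k1.+1], the extra expansion is for the components of [u], which are applications in argument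
   position; the other [k1] are for [u] in head position. *)
have D' : le (rank CD).+1 (expands k1.+1 CD V ⊕ ecst 1) d.
  rewrite /d (sem_app _ pP tA) (head_sem_intro pP H) // -/X.
  have N : k1.+1 + k.+1 <= height P by have := height_zeta A C D; rewrite -/CD -/P -/k -/k1; lia.
  apply: le_trans (app_le bq (expands_leq N XX) ttq).
  rewrite /expands iterD -/(expands _ _ _) -/(expands k.+1 P X).
  have YY' := expands_le k.+1 XX.
  apply: le_trans (app_expands k1.+1 YY' tt).
  apply: le_trans (expands_add_cst k1.+1 _ VV) _; apply: expands_le.
  apply: le_trans YV _; apply: app_le => //.
  exact: le_weaken (expands_ge k1.+1 tt).
have U : le (rank CD).+1 (arg_sem u rho) (expand CD V).
  rewrite arg_sem_intro // sem_prod.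
  rewrite (arg_sem_neutral rt H) // (arg_sem_neutral st H) //.
  exact: (expands_conj 1 rs ss).
have uu := arg_sem_le uT H.
rewrite /expands iterSr -/(expands _ _ _) in D'.
split; apply: (le_trans _ D'); apply: le_add_cst.
  by apply: le_trans (head_sem_expands uT H (leqnn _)) _; exact: expands_le.
by apply: (le_trans U); apply: expands_ge; exact: le_refl_r U.
Qed.

(** The body of the new abstraction has exactly the value of the body in [expand (Arr A B)]; only
    the bookkeeping summands differ, [width B] being at most [width A * width B]. *)
Lemma eta_le A B r rho : r ∈ Arr A B -> neutral r -> env_le rho rho ->
  le (rank (Arr A B)).+1
    (arg_sem (Lam (cls A) (rename (shift (cls A)) r @ Var (cls A) 0)%P) rho)
    (arg_sem r rho).
Proof.
move=> rAB nr H; have [aq bq] := rank_arr A B.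
have rAB' := typing_rename (shift (cls A)) rAB.
have bB := typing_app rAB' (typing_var A 0).
rewrite (arg_sem_neutral rAB H nr) arg_sem_intro // (sem_lam _ _ bB).
have [wA wB] := (width_gt0 A, width_gt0 B).
have M : monoE (rank A) (rank B) (fun x =>
    arg_sem (rename (shift (cls A)) r @ Var (cls A) 0)%P (extend (cls A) x rho)).
  by move=> x x' xx'; apply: arg_sem_le => //; exact: env_le_extend.
apply: lm_le => //; first by nia.
  exact: monoE_expand (sem_le rAB H).
move=> x xx; have Hx := env_le_extend H xx.
suff E : arg_sem (rename (shift (cls A)) r @ Var (cls A) 0)%P (extend (cls A) x rho) =
  expand B (app (rank (Arr A B)) (rank B) (sem r rho) (expand A x)).
  by have := M _ _ xx; rewrite {2}E.
rewrite (arg_sem_neutral bB Hx) // (sem_app _ rAB' (typing_var A 0)).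
rewrite head_sem_neutral ?neutral_rename // (sem_shift _ _ _ rAB).
by rewrite (arg_sem_neutral (typing_var A 0) Hx) //= /extend eqxx.
Qed.

Lemma delta_eq A B r rho : r ∈ Conj A B -> neutral r -> env_le rho rho ->
  arg_sem (Proj A r × Proj B r)%P rho = arg_sem r rho.
Proof.
move=> rAB nr H; have rBA := typing_equiv rAB (tyequiv_comm _ _).
rewrite (arg_sem_neutral rAB H nr) arg_sem_intro // sem_prod.
rewrite (arg_sem_neutral (typing_proj rAB) H) // (arg_sem_neutral (typing_proj rBA) H) //=.
by rewrite /head_val nr.
Qed.

(** * Counting expansions *)

(** Subtracting 1 makes the weight of a conjunction exceed the sum of the weights of its conjuncts,
    which pays for delta. Delta also copies the expanded term, so [arg_wt] multiplies by the
    weight. *)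
Definition weight (A : ty) : nat := 2 * vol A - 1.

Definition arg_wt (r : preterm) (n : nat) : nat :=
  if neutral r then weight (type_of r) * n.+1 else n.

Fixpoint head_size (r : preterm) : nat :=
  match r with
  | Var U n => 0
  | Lam U r => arg_wt r (head_size r)
  | App r s => head_size r + arg_wt s (head_size s)
  | Prod r s => arg_wt r (head_size r) + arg_wt s (head_size s)
  | Proj A r => head_size r
  end.

(* Bounds the expansions still possible in [r] outside head position; [head_size]
   does so in head position, where [r] itself cannot expand. *)
Definition arg_size r := arg_wt r (head_size r).

Lemma weight_gt0 A : 0 < weight A.
Proof. by have := vol_gt0 A; rewrite /weight; lia. Qed.

Lemma arg_wtE r A n : r ∈ A -> arg_wt r n = if neutral r then weight A * n.+1 else n.
Proof. by move=> rA; rewrite /arg_wt /weight (vol_equiv (type_of_equiv rA)). Qed.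

Lemma arg_wt_lt r s A m n : r ∈ A -> s ∈ A -> neutral r = neutral s -> m < n ->
  arg_wt s m < arg_wt r n.
Proof.
move=> rA sA rs mn; rewrite (arg_wtE _ rA) (arg_wtE _ sA) rs; case: ifP => // _.
by rewrite ltn_pmul2l ?weight_gt0.
Qed.

Lemma size_le_arg r : head_size r <= arg_size r.
Proof.
rewrite /arg_size /arg_wt; case: ifP => // _.
by apply: leq_trans (leqnSn _) _; rewrite leq_pmull // weight_gt0.
Qed.

Lemma arg_size_gt0 r : 0 < arg_size r.
Proof.
elim: r => [U n|U r IH|r _ s _|r IH s _|A r _] //;
  rewrite /arg_size /arg_wt /= ?muln_gt0 ?weight_gt0 //.
by rewrite -/(arg_size r) ltn_addr.
Qed.

Lemma size_rename f r A : r ∈ A -> head_size (rename f r) = head_size r.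
Proof.
have W g t B n : t ∈ B -> arg_wt (rename g t) n = arg_wt t n.
  by move=> tB; rewrite /arg_wt neutral_rename (type_of_rename _ tB).
move=> rA; elim: rA f => {r A} //=.
- by move=> A B r rB IH f; rewrite (W _ _ _ _ rB) IH.
- by move=> A B r s rAB IHr sA IHs f; rewrite (W _ _ _ _ sA) IHr IHs.
- by move=> A B r s rA IHr sB IHs f; rewrite (W _ _ _ _ rA) (W _ _ _ _ sB) IHr IHs.
Qed.

Lemma eta_size A B r : r ∈ Arr A B -> neutral r ->
  arg_size (Lam (cls A) (rename (shift (cls A)) r @ Var (cls A) 0)%P) < arg_size r.
Proof.
move=> rAB nr; have rAB' := typing_rename (shift (cls A)) rAB.
change (arg_size (rename (shift (cls A)) r @ Var (cls A) 0)%P < arg_size r).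
rewrite /arg_size (arg_wtE _ (typing_app rAB' (typing_var A 0))) (arg_wtE _ rAB) nr.
rewrite [head_size (_ @ _)%P]/= (arg_wtE _ (typing_var A 0)) /=.
rewrite (size_rename _ rAB) /weight /=.
have [vA vB] := (vol_gt0 A, vol_gt0 B).
have e2 : 2 * vol A <= 2 ^ vol A.
  by rewrite -{1}(prednK vA) -{2}(prednK vA) expnS leq_mul2l /=; exact: ltn_expl.
move: (vol A) (vol B) (2 ^ vol A) (head_size r) vA vB e2 => a b e n vA vB e2.
(* From [2 * a <= e], the weight of the arrow is at least [4 * (a * b) - 1], whereas the weight of
   [B] times [2 * a] is only [4 * (a * b) - 2 * a]. *)
apply: (@leq_trans ((4 * (a * b) - 1) * n.+1)); last by rewrite leq_mul2r; nia.
apply: (@leq_ltn_trans ((2 * b - 1) * (2 * a * n.+1))); first by rewrite leq_mul2l; nia.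
by rewrite mulnA ltn_pmul2r //; nia.
Qed.

Lemma delta_size A B r : r ∈ Conj A B -> neutral r ->
  arg_size (Proj A r × Proj B r)%P < arg_size r.
Proof.
move=> rAB nr; have rBA := typing_equiv rAB (tyequiv_comm _ _).
change (arg_size (Proj A r) + arg_size (Proj B r) < arg_size r).
rewrite /arg_size (arg_wtE _ rAB) nr.
rewrite (arg_wtE _ (typing_proj rAB)) (arg_wtE _ (typing_proj rBA)) /= /weight /=.
by have [vA vB] := (vol_gt0 A, vol_gt0 B); nia.
Qed.

Lemma pi_size A r s : r ∈ A ->
  head_size r < head_size (Proj A (r × s)%P) /\ arg_size r < arg_size (Proj A (r × s)%P).
Proof.
move=> rA; have sr := size_le_arg r; have s0 := arg_size_gt0 s.
have H : arg_size r < head_size (Proj A (r × s)%P).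
  by rewrite /= -/(arg_size r) -/(arg_size s) -addn1 leq_add2l.
split; first exact: leq_ltn_trans H.
exact: leq_trans H (size_le_arg _).
Qed.

(** * Invariance under the isomorphisms *)

Lemma lm_widen q q' a b b' m n F : a < q' -> b <= q' -> q' <= q -> b <= b' ->
  (forall x, tr a.+1 x = x -> tr b.+1 (F x) = F x) ->
  lm q' a b m n F = lm q a b' m n F.
Proof.
move=> aq bq qq' bb' FP; rewrite /lm (mk_wide _ qq'); apply: mk_eq => e eP.
rewrite (tr_tr eP) // (tr_level0 eP); last exact: leq_trans aq.
by rewrite (ev_tr_wide _ eP bq) (ev_wide (FP _ (trK _ _)) eP bb').
Qed.

Lemma lm_add q a b m m' n n' F G :
  lm q a b (m + m') (n + n') (fun x => F x ⊕ G x) = lm q a b m n F ⊕ lm q a b m' n' G.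
Proof. by rewrite /lm -mk_add; apply: mk_eq => e _; rewrite ev_add; lia. Qed.

Lemma lm_eq q a b m n F G : (forall x, tr a.+1 x = x -> F x = G x) ->
  lm q a b m n F = lm q a b m n G.
Proof. by move=> FG; apply: mk_eq => e _; rewrite FG ?trK. Qed.

Definition env_bnd (rho : env) : Prop :=
  forall A n, tr (rank A).+1 (rho (cls A) n) = rho (cls A) n.

Lemma env_bnd_extend A x rho : env_bnd rho -> tr (rank A).+1 x = x ->
  env_bnd (extend (cls A) x rho).
Proof.
move=> H xP B n; rewrite /extend; case: eqP => [/clsP/rank_equiv E|_]; last exact: H.
by case: n => [|n]; [rewrite E|exact: H].
Qed.

Lemma arg_val_bnd r A d : r ∈ A -> tr (rank A).+1 d = d ->
  tr (rank A).+1 (arg_val r d) = arg_val r d.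
Proof. by move=> rA dP; rewrite (arg_valE rA dP); case: ifP => // _; exact: expand_bnd. Qed.

Lemma sem_bnd r A rho : r ∈ A -> env_bnd rho -> tr (rank A).+1 (sem r rho) = sem r rho.
Proof.
move=> rA; elim: rA rho => {r A}.
- by move=> A n rho; exact.
- by move=> r A B _ IH /rank_equiv <-.
- by move=> A B r rB _ rho _; rewrite (sem_lam _ _ rB); exact: mk_bnd.
- by move=> A B r s rAB _ sA _ rho _; rewrite (sem_app _ rAB sA); exact: mk_bnd.
- move=> A B r s rA IHr sB IHs rho H; have [aM bM] := rank_conj A B.
  rewrite sem_prod tr_add; congr eadd.
    by apply: (tr_weaken _ (arg_val_bnd rA (IHr _ H))).
  by apply: (tr_weaken _ (arg_val_bnd sB (IHs _ H))).
by move=> A B r _ _ rho _; exact: trK.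
Qed.

Lemma arg_sem_bnd r A rho : r ∈ A -> env_bnd rho ->
  tr (rank A).+1 (arg_sem r rho) = arg_sem r rho.
Proof. by move=> rA H; exact: arg_val_bnd (sem_bnd rA H). Qed.

(** Between terms of the same type, these three data determine the values and sizes in both
    positions, so the relation passes through all contexts. *)
Definition same_sem r s : Prop :=
  [/\ neutral r = neutral s, head_size r = head_size s &
      forall rho, env_bnd rho -> sem r rho = sem s rho].

Lemma same_arg_sem r s A rho : r ∈ A -> s ∈ A -> same_sem r s -> env_bnd rho ->
  arg_sem r rho = arg_sem s rho.
Proof.
move=> rA sA [E _ H] /H.
by rewrite /arg_sem /arg_val E (type_of_eq rA sA) => ->.
Qed.

Lemma same_head_sem r s A rho : r ∈ A -> s ∈ A -> same_sem r s -> env_bnd rho ->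
  head_sem r rho = head_sem s rho.
Proof.
move=> rA sA [E _ H] /H.
by rewrite /head_sem /head_val E (type_of_eq rA sA) => ->.
Qed.

Lemma same_arg_size r s A : r ∈ A -> s ∈ A -> same_sem r s -> arg_size r = arg_size s.
Proof. by move=> rA sA [E S _]; rewrite /arg_size /arg_wt E S (type_of_eq rA sA). Qed.

Lemma same_sem_iso_step r s A : r ⇄ s -> r ∈ A -> same_sem r s.
Proof.
move=> rs; elim: rs A => {r s}.
- by move=> r s A _; split=> //= [|rho _]; [exact: addnC|exact: eaddC].
- move=> r s t A _; split=> //=; first by rewrite /arg_wt /= addnA.
  by move=> rho _; rewrite /arg_val /= eaddA.
- move=> U r s A /typing_lam_inv[B [C [-> rsC _]]].
  have /typing_prod_inv[C1 [C2 [rC1 sC2 CE]]] := rsC.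
  split=> //= rho H.
  have rsC' := typing_prod rC1 sC2.
  rewrite -/(sem (Lam (cls B) (r × s)%P) rho) -/(sem (Lam (cls B) r) rho) -/(sem (Lam (cls B) s) rho).
  rewrite (sem_lam _ _ rsC').
  have -> : arg_val (Lam (cls B) r) (sem (Lam (cls B) r) rho) = sem (Lam (cls B) r) rho by [].
  have -> : arg_val (Lam (cls B) s) (sem (Lam (cls B) s) rho) = sem (Lam (cls B) s) rho by [].
  rewrite (sem_lam _ _ rC1) (sem_lam _ _ sC2).
  have [aq bq] := rank_arr B C1; have [aq' bq'] := rank_arr B C2.
  rewrite (@lm_widen (rank (Arr B (Conj C1 C2))) _ _ _ (rank (Conj C1 C2)) _ _ _ aq bq);
    [|by rewrite /=; lia|by rewrite /=; lia|].
    rewrite (@lm_widen (rank (Arr B (Conj C1 C2))) _ _ _ (rank (Conj C1 C2)) _ _ _ aq' bq');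
      [|by rewrite /=; lia|by rewrite /=; lia|].
      by rewrite -lm_add.
    by move=> x xP; apply: arg_sem_bnd => //; exact: env_bnd_extend.
  by move=> x xP; apply: arg_sem_bnd => //; exact: env_bnd_extend.
- move=> r s t A /typing_app_inv[B /typing_app_inv[C rC sC] tB].
  split=> //=; first by rewrite /arg_wt /= addnA.
  have rC' := typing_equiv rC (tyequiv_sym (tyequiv_curry C B A)).
  move=> rho H.
  rewrite -/(sem (r @ s @ t)%P rho) -/(sem (r @ (s × t))%P rho).
  rewrite (sem_app _ (typing_app rC sC) tB) (sem_app _ rC' (typing_prod sC tB)).
  rewrite head_sem_neutral // (sem_app _ rC sC) (@arg_sem_intro (s × t)%P) // sem_prod.
  have [aq bq] := rank_arr B A.
  rewrite app_app //; last exact: tr_weaken aq (arg_sem_bnd tB H).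
  by rewrite (rank_equiv (tyequiv_curry C B A)).
- move=> r s rs IH A sA; have [E S H] := IH A ((typing_iso_step A rs).2 sA).
  by split=> // rho /H.
- move=> U r s rs IH A /typing_lam_inv[B [C [-> rC _]]].
  have sC := (typing_iso_step C rs).1 rC; have E := IH _ rC.
  split=> //; first exact: same_arg_size rC sC E.
  move=> rho H; rewrite (sem_lam _ _ rC) (sem_lam _ _ sC); apply: lm_eq => x xP.
  by apply: (same_arg_sem rC sC E); exact: env_bnd_extend.
- move=> r s t rs IH A /typing_app_inv[B rB tB].
  have sB := (typing_iso_step _ rs).1 rB; have E := IH _ rB.
  split=> //; first by case: E => _ S _; rewrite /= S.
  by move=> rho H; rewrite (sem_app _ rB tB) (sem_app _ sB tB) (same_head_sem rB sB E H).
- move=> r s t rs IH A /typing_app_inv[B tB rB].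
  have sB := (typing_iso_step _ rs).1 rB; have E := IH _ rB.
  split=> //; first by rewrite /= -/(arg_size r) (same_arg_size rB sB E).
  by move=> rho H; rewrite (sem_app _ tB rB) (sem_app _ tB sB) (same_arg_sem rB sB E H).
- move=> r s t rs IH A /typing_prod_inv[B [C [rB tC _]]].
  have sB := (typing_iso_step _ rs).1 rB; have E := IH _ rB.
  split=> //; first by rewrite /= -/(arg_size r) (same_arg_size rB sB E).
  by move=> rho H; rewrite !sem_prod (same_arg_sem rB sB E H).
- move=> r s t rs IH A /typing_prod_inv[B [C [tB rC _]]].
  have sC := (typing_iso_step _ rs).1 rC; have E := IH _ rC.
  split=> //; first by rewrite /= -/(arg_size r) (same_arg_size rC sC E).
  by move=> rho H; rewrite !sem_prod (same_arg_sem rC sC E H).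
- move=> B r s rs IH A /typing_proj_inv[_ [C rC]].
  have sC := (typing_iso_step _ rs).1 rC; have E := IH _ rC.
  split=> //; first by case: E.
  by move=> rho H; rewrite !sem_proj (same_head_sem rC sC E H).
Qed.

(** * Decrease of the measure *)

Definition arg_decr A r s : Prop := exists k,
  (forall rho, env_le rho rho ->
     le (rank A).+1 (arg_sem s rho ⊕ ecst k) (arg_sem r rho)) /\
  (0 < k \/ arg_size s < arg_size r).

(** Steps of [hook] may take place in head position, those of [red] only in argument position; hence
    two notions. The surplus [k] is chosen before the environment so that it survives
    abstraction. *)
Definition hook_decr A r s : Prop := exists k,
  (forall rho, env_le rho rho ->
     le (rank A).+1 (head_sem s rho ⊕ ecst k) (head_sem r rho) /\
     le (rank A).+1 (arg_sem s rho ⊕ ecst k) (arg_sem r rho)) /\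
  (0 < k \/ head_size s < head_size r /\ arg_size s < arg_size r).

Lemma hook_decr_arg A r s : hook_decr A r s -> arg_decr A r s.
Proof.
move=> [k [H D]]; exists k; split; first by move=> rho /H[].
by case: D => [|[_]]; [left|right].
Qed.

Lemma hook_decr_congr A r s k : r ∈ A -> s ∈ A -> neutral r = neutral s ->
  (forall rho, env_le rho rho -> le (rank A).+1 (sem s rho ⊕ ecst k) (sem r rho)) ->
  (0 < k \/ head_size s < head_size r) -> hook_decr A r s.
Proof.
move=> rA sA rs H D; exists k; split=> [rho P|].
  by split; [apply: head_val_add_cst|apply: arg_val_add_cst] => //; try exact: H; exact: sem_le.
case: D => [|D]; [by left|right; split=> //]; exact: (arg_wt_lt rA sA rs D).
Qed.

(** For root redexes: [r] is neutral but [s] may be an introduction, so the unexpanded value of [r]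
    has to dominate both values of [s]. *)
Lemma hook_decr_neutral A r s k : r ∈ A -> neutral r ->
  (forall rho, env_le rho rho -> le (rank A).+1 (head_sem s rho ⊕ ecst k) (sem r rho) /\
    le (rank A).+1 (arg_sem s rho ⊕ ecst k) (sem r rho)) ->
  (0 < k \/ head_size s < head_size r /\ arg_size s < arg_size r) -> hook_decr A r s.
Proof.
move=> rA nr H D; exists k; split=> // rho P; have [h a] := H _ P.
rewrite (head_sem_neutral _ nr) (arg_sem_neutral rA P nr); split=> //.
by apply: (le_trans a); apply: expand_ge; exact: sem_le.
Qed.

Lemma betapizeta_decr A r s : red_betapizeta r s -> r ∈ A -> hook_decr A r s.
Proof.
case=> {r s}.
- move=> B r s sB rA; have /typing_app_inv[B' lA sB'] := rA.
  have lB : Lam (cls B) r ∈ Arr B A.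
    apply: typing_equiv lA _; apply: tyequiv_arr tyequiv_refl; exact: typing_unique sB' sB.
  apply: (hook_decr_neutral (k := 1) rA) => //; last by left.
  by move=> rho H; exact: (beta_le (typing_lam_beta lB) sB H).
- move=> B r s rB rA; have /typing_proj_inv[/rank_equiv E [C /typing_prod_inv[X [Y [_ sY _]]]]] := rA.
  apply: (hook_decr_neutral (k := 0) rA) => //.
    by move=> rho H; rewrite !eadd0 -E; exact: (pi_le rB sY H).
  by right; exact: pi_size rB.
- move=> r s t rA; have /typing_app_inv[B /typing_prod_inv[R [S [rR sS E]]] tB] := rA.
  have [C [D [/rank_equiv AE RE SE]]] := conj_arr_split E.
  apply: (hook_decr_neutral (k := 1) rA) => //; last by left.
  by move=> rho H; rewrite AE; exact: (zeta_le (typing_equiv rR RE) (typing_equiv sS SE) tB H).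
Qed.

Lemma etadelta_decr A r s : red_etadelta r s -> r ∈ A -> arg_decr A r s.
Proof.
case=> {r s} [B C r rBC nr rA|B C r rBC nr rA]; exists 0;
  have /rank_equiv <- := typing_unique rBC rA.
  split=> [rho H|]; first by rewrite eadd0; exact: (eta_le rBC nr H).
  by right; exact: (eta_size rBC nr).
split=> [rho H|]; last by right; exact: (delta_size rBC nr).
by rewrite eadd0 (delta_eq rBC nr H); exact: arg_sem_le.
Qed.

Lemma hook_red_decr :
  (forall r s, r ↪ s -> forall A, r ∈ A -> hook_decr A r s) /\
  (forall r s, r ⟶ s -> forall A, r ∈ A -> arg_decr A r s).
Proof.
have [TH TR] := typing_hook_red; apply: hook_red_ind.
- by move=> r s rs A; exact: betapizeta_decr.
- move=> U r s rs IH A rA; have sA := TH _ _ (hook_lam U rs) _ rA.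
  have /typing_lam_inv[B [C [E rC /rank_equiv AE]]] := rA; subst U.
  have sC := TR _ _ rs _ rC; have [k [H D]] := IH _ rC; have [aq bq] := rank_arr B C.
  apply: (@hook_decr_congr _ _ _ k) => // rho P.
  rewrite -AE (sem_lam _ _ rC) (sem_lam _ _ sC).
  rewrite -lm_cst.
  have M t : t ∈ C -> monoE (rank B) (rank C) (fun x => arg_sem t (extend (cls B) x rho)).
    by move=> tC x x' xx'; apply: arg_sem_le => //; exact: env_le_extend.
  apply: lm_le => //; [|exact: (M r rC)|].
    by move=> x x' xx'; apply: le_add_cst; exact: (M s sC).
  by move=> x xx; apply: H; exact: env_le_extend.
- move=> r s t rs IH A rA; have sA := TH _ _ (hook_appl t rs) _ rA.
  have /typing_app_inv[B rB tB] := rA; have sB := TH _ _ rs _ rB.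
  have [k [H D]] := IH _ rB; have [aq bq] := rank_arr B A.
  apply: (@hook_decr_congr _ _ _ k) => // [rho P|]; last first.
    by case: D => [|[D _]]; [left|right; rewrite /= ltn_add2r].
  rewrite (sem_app _ rB tB) (sem_app _ sB tB) -app_cstl; apply: app_le => //.
    exact: (H _ P).1.
  exact: le_weaken aq (arg_sem_le tB P).
- move=> r s t rs IH A rA; have sA := TH _ _ (hook_appr t rs) _ rA.
  have /typing_app_inv[B tB rB] := rA; have sB := TR _ _ rs _ rB.
  have [k [H D]] := IH _ rB; have [aq bq] := rank_arr B A.
  apply: (@hook_decr_congr _ _ _ k) => // [rho P|]; last first.
    by case: D => [|D]; [left|right; rewrite /= ltn_add2l].
  rewrite (sem_app _ tB rB) (sem_app _ tB sB).
  have ht := head_sem_le tB P.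
  apply: le_trans (app_cstr _ _ bq ht _) (app_le bq ht _); first exact: leq_ltn_trans aq.
    exact: le_weaken aq (arg_sem_le sB P).
  exact: le_weaken aq (H _ P).
- move=> r s t rs IH A rA; have sA := TH _ _ (hook_prodl t rs) _ rA.
  have /typing_prod_inv[B [C [rB tC /rank_equiv AE]]] := rA.
  have [k [H D]] := IH _ rB; have [aM bM] := rank_conj B C.
  apply: (@hook_decr_congr _ _ _ k) => // [rho P|]; last first.
    by case: D => [|D]; [left|right; rewrite /= ltn_add2r].
  rewrite !sem_prod -AE -eaddA (eaddC _ (ecst k)) eaddA; apply: le_add.
    exact: le_weaken (H _ P).
  exact: le_weaken (arg_sem_le tC P).
- move=> r s t rs IH A rA; have sA := TH _ _ (hook_prodr t rs) _ rA.
  have /typing_prod_inv[B [C [tB rC /rank_equiv AE]]] := rA.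
  have [k [H D]] := IH _ rC; have [aM bM] := rank_conj B C.
  apply: (@hook_decr_congr _ _ _ k) => // [rho P|]; last first.
    by case: D => [|D]; [left|right; rewrite /= ltn_add2l].
  rewrite !sem_prod -AE -eaddA; apply: le_add.
    exact: le_weaken (arg_sem_le tB P).
  exact: le_weaken (H _ P).
- move=> B r s rs IH A rA; have sA := TH _ _ (hook_proj B rs) _ rA.
  have /typing_proj_inv[/rank_equiv AE [C rC]] := rA.
  have [k [H D]] := IH _ rC.
  apply: (@hook_decr_congr _ _ _ k) => // [rho P|]; last first.
    by case: D => [|[D _]]; [left|right].
  rewrite !sem_proj -AE -(tr_cst (rank B) k) -tr_add.
  exact: le_tr (H _ P).1.
- by move=> r s rs A; exact: etadelta_decr.
- by move=> r s rs IH A /IH/hook_decr_arg.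
Qed.

Definition env0 : env := fun _ _ => ecst 0.

(** A whole term may be expanded at its root, so it counts as standing in argument position. Level 0
    is the value at arguments 0. *)
Definition measure (r : preterm) : nat := arg_sem r env0 0.

Lemma iso_invariant r s A : iso r s -> r ∈ A ->
  [/\ s ∈ A, measure s = measure r & arg_size s = arg_size r].
Proof.
elim=> {r s} [r s rs rA|//|r s t _ IH1 _ IH2 /IH1[sA E1 E2]].
  have sA := (typing_iso_step A rs).1 rA; have E := same_sem_iso_step rs rA.
  split=> //; last exact/esym/(same_arg_size rA sA E).
  by rewrite /measure (same_arg_sem rA sA E) // => B n; exact: tr0.
by have [tA -> ->] := IH2 sA.
Qed.

Lemma red_mod_decr r s A : r ⇝ s -> r ∈ A ->
  s ∈ A /\ (measure s < measure r \/
            measure s <= measure r /\ arg_size s < arg_size r).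
Proof.
move=> [r' [s' [rr' rs ss']]] rA; have [rA' <- <-] := iso_invariant rr' rA.
have sA' := typing_hook_red.2 _ _ rs _ rA'.
have [sA -> ->] := iso_invariant ss' sA'; split=> //.
have [k [H D]] := hook_red_decr.2 _ _ rs _ rA'.
have /le_level0 : le (rank A).+1 (arg_sem s' env0 ⊕ ecst k) (arg_sem r' env0).
  by apply: H => B n; exact: le00.
rewrite /= -/(measure s') -/(measure r') => M.
have {}M : measure s' + k <= measure r' by exact: M.
by case: D => D; [left|right; split=> //]; lia.
Qed.

Theorem mainTheorem2 (r : preterm) (A : ty) (hr : typing r A) :
  strongly_normalising r.
Proof.
move=> [f [f0 fS]].
have H m n i : f i ∈ A -> measure (f i) < m -> arg_size (f i) < n -> False.
  elim: m n i => // m IHm n; elim: n => // n IHn i fA fm fn.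
  have [fA' [lt|[le lt]]] := red_mod_decr (fS i) fA.
    (* When the measure drops the size may grow, so its bound is chosen afresh. *)
    by apply: (IHm (arg_size (f i.+1)).+1 i.+1) => //; exact: leq_trans lt _.
  by apply: (IHn i.+1) => //; [exact: leq_ltn_trans le fm|exact: leq_trans lt _].
by apply: (H _ _ 0 _ (leqnn _) (leqnn _)); rewrite f0.
Qed.
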